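(* Let $R$ be a Cohen-Macaulay local ring of dimension $d\geq 1$ with a canonical module $\omega_R$. Let $M$ and $N$ be finitely generated $R$-modules with $N$ maximal Cohen-Macaulay. If $\operatorname{Tor}^R_j(M,N^\dagger)=0$ for all $j=1,\dots,d$, then the following statements are equivalent: (i) $M\otimes_RN^\dagger$ is maximal Cohen-Macaulay; (ii) $\operatorname{Ext}^i_R(M,N)=0$ for all $i=1,\dots,d$.
   Context: All rings are commutative, unital and Noetherian. $N^\dagger=\operatorname{Hom}_R(N,\omega_R)$ denotes the canonical dual of $N$. A finitely generated $R$-module is maximal Cohen-Macaulay if its depth equals $\dim R$.
   Formalization: The module M is assumed nonzero: for M = 0 the Tor condition and (ii) hold, but M ⊗ N† = 0 has infinite depth and so is not maximal Cohen-Macaulay, and the equivalence fails. *)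

(* Defs.v *)
From HB Require Import structures.
From mathcomp Require Import all_boot all_algebra generic_quotient.
From mathcomp Require Import boolp classical_sets.
From mathcomp Require Import freeg.

Set Implicit Arguments.
Unset Strict Implicit.
Unset Printing Implicit Defensive.

Import GRing.Theory.
Local Open Scope ring_scope.
Local Open Scope quotient_scope.
Local Open Scope classical_set_scope.

Section Span.
Variables (R : pzRingType) (V : lmodType R).
Implicit Types (S T : set V).

Definition submodule S :=
  S 0 /\ forall (a : R) (u v : V), S u -> S v -> S (a *: u + v).

Definition lin_span S : set V := smallest submodule S.

Lemma span_submodule S : submodule (lin_span S).
Proof.
split=> [T [[]]//|a u v Su Sv T [sT ST]].
by apply: sT.2; [apply: Su | apply: Sv].
Qed.

Lemma sub_span S : S `<=` lin_span S.
Proof. exact: sub_gen_smallest. Qed.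

Lemma span_sub S T : submodule T -> S `<=` T -> lin_span S `<=` T.
Proof. exact: smallest_sub. Qed.

Lemma span0 S : lin_span S 0.
Proof. exact: (span_submodule S).1. Qed.

Lemma spanP S a u v : lin_span S u -> lin_span S v -> lin_span S (a *: u + v).
Proof. exact: (span_submodule S).2. Qed.

Lemma spanD S u v : lin_span S u -> lin_span S v -> lin_span S (u + v).
Proof. by move=> Su Sv; rewrite -[u]scale1r; apply: spanP. Qed.

Lemma spanZ S a u : lin_span S u -> lin_span S (a *: u).
Proof. by move=> Su; rewrite -[_ *: _]addr0; apply: spanP => //; apply: span0. Qed.

Lemma spanN S u : lin_span S u -> lin_span S (- u).
Proof. by rewrite -scaleN1r; apply: spanZ. Qed.

Definition fingen := exists s : seq V, lin_span [set` s] = setT.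

Definition trivial_module := forall v : V, v = 0.
End Span.

Definition isomorphic (R : pzRingType) (U V : lmodType R) :=
  exists f : {linear U -> V}, bijective f.

(* The quotient of V by the submodule generated by S. *)
Section Quotient.
Variables (R : pzRingType) (V : lmodType R) (S : set V).

Definition quo_rel (x y : V) : bool := `[< lin_span S (x - y) >].

Lemma quo_rel_refl : reflexive quo_rel.
Proof. by move=> x; apply/asboolP; rewrite subrr; apply: span0. Qed.

Lemma quo_rel_sym : symmetric quo_rel.
Proof.
by move=> x y; apply/asboolP/asboolP => /spanN; rewrite opprB.
Qed.

Lemma quo_rel_trans : transitive quo_rel.
Proof.
move=> y x z /asboolP xy /asboolP yz; apply/asboolP.
by have := spanD xy yz; rewrite addrA subrK.
Qed.

Canonical quo_equiv := EquivRel quo_rel quo_rel_refl quo_rel_sym quo_rel_trans.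
Canonical quo_equiv_direct := defaultEncModRel quo_rel.

Definition quo := {eq_quot quo_rel}.

HB.instance Definition _ := Choice.on quo.
HB.instance Definition _ := EqQuotient.on quo.

Lemma quo_eqP (x y : V) : \pi_quo x = \pi_quo y <-> lin_span S (x - y).
Proof. by split=> [/eqquotP/asboolP//|xy]; apply/eqquotP/asboolP. Qed.

Definition quo_add (x y : quo) : quo := \pi_quo (repr x + repr y).
Definition quo_opp (x : quo) : quo := \pi_quo (- repr x).
Definition quo_scale (a : R) (x : quo) : quo := \pi_quo (a *: repr x).

Lemma span_repr x : lin_span S (repr (\pi_quo x) - x).
Proof. by apply/quo_eqP; rewrite reprK. Qed.

Lemma pi_quoD x y : \pi_quo (x + y) = quo_add (\pi_quo x) (\pi_quo y).
Proof.
apply/esym/quo_eqP; rewrite opprD addrACA.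
by apply: spanD; apply: span_repr.
Qed.

Lemma pi_quoN x : \pi_quo (- x) = quo_opp (\pi_quo x).
Proof. by apply/esym/quo_eqP; rewrite -opprD; apply: spanN; apply: span_repr. Qed.

Lemma pi_quoZ a x : \pi_quo (a *: x) = quo_scale a (\pi_quo x).
Proof. by apply/esym/quo_eqP; rewrite -scalerBr; apply: spanZ; apply: span_repr. Qed.

Lemma quo_addA : associative quo_add.
Proof.
elim/quotW=> x; elim/quotW=> y; elim/quotW=> z.
by rewrite -(pi_quoD y) -(pi_quoD x y) -2!pi_quoD addrA.
Qed.

Lemma quo_addC : commutative quo_add.
Proof. by elim/quotW=> x; elim/quotW=> y; rewrite -!pi_quoD addrC. Qed.

Lemma quo_add0 : left_id (\pi_quo 0) quo_add.
Proof. by elim/quotW=> x; rewrite -pi_quoD add0r. Qed.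

Lemma quo_addN : left_inverse (\pi_quo 0) quo_opp quo_add.
Proof. by elim/quotW=> x; rewrite -(pi_quoN x) -pi_quoD addNr. Qed.

HB.instance Definition _ :=
  GRing.isZmodule.Build quo quo_addA quo_addC quo_add0 quo_addN.

Lemma quo_scaleA a b x : quo_scale a (quo_scale b x) = quo_scale (a * b) x.
Proof. by elim/quotW: x => x; rewrite -(pi_quoZ b) -2!pi_quoZ scalerA. Qed.

Lemma quo_scale1 : left_id 1 quo_scale.
Proof. by elim/quotW=> x; rewrite -pi_quoZ scale1r. Qed.

Lemma quo_scaleDr : right_distributive quo_scale +%R.
Proof.
move=> a; elim/quotW=> x; elim/quotW=> y.
by rewrite -[X in quo_scale a X]pi_quoD -(pi_quoZ a x) -(pi_quoZ a y) -pi_quoZ scalerDr pi_quoD.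
Qed.

Lemma quo_scaleDl x : {morph quo_scale^~ x : a b / a + b}.
Proof. by elim/quotW: x => x a b; rewrite -(pi_quoZ a) -(pi_quoZ b) -pi_quoZ scalerDl pi_quoD. Qed.

HB.instance Definition _ := GRing.Zmodule_isLmodule.Build R quo
  quo_scaleA quo_scale1 quo_scaleDr quo_scaleDl.

Definition quo_pi (x : V) : quo := \pi_quo x.

Lemma quo_pi_linear : linear quo_pi.
Proof. by move=> a x y; rewrite /quo_pi pi_quoD pi_quoZ. Qed.

HB.instance Definition _ := GRing.isLinear.Build R V quo *:%R quo_pi
  quo_pi_linear.

Lemma quo_pi_eq0 x : quo_pi x = 0 <-> lin_span S x.
Proof. by rewrite -{2}[x]subr0; apply: quo_eqP. Qed.

Section Lift.
Variables (W : lmodType R) (g : {linear V -> W}).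
Hypothesis gS : forall x, S x -> g x = 0.

Definition quo_lift_fun (x : quo) : W := g (repr x).

Lemma quo_lift_funE x : quo_lift_fun (quo_pi x) = g x.
Proof.
have gspan : lin_span S `<=` [set y | g y = 0].
  apply: span_sub => //; split=> [|a u v /= gu gv]; first exact: linear0.
  by rewrite linearP gu gv scaler0 addr0.
by apply/eqP; rewrite -subr_eq0 -linearB; apply/eqP; apply: gspan; apply: span_repr.
Qed.

Lemma quo_lift_linear : linear quo_lift_fun.
Proof.
move=> a; elim/quotW=> x; elim/quotW=> y.
by rewrite -![\pi x]/(quo_pi x) -![\pi y]/(quo_pi y) -linearP !quo_lift_funE linearP.
Qed.

Definition quo_lift : {linear quo -> W} :=
  HB.pack quo_lift_fun (GRing.isLinear.Build R quo W *:%R quo_lift_fun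
    quo_lift_linear).

Lemma quo_liftE x : quo_lift (quo_pi x) = g x.
Proof. exact: quo_lift_funE. Qed.
End Lift.
End Quotient.

Section Kernel.
Variables (R : pzRingType) (U V : lmodType R) (f : {linear U -> V}).

Definition in_ker : {pred U} := [pred x | f x == 0].

Lemma in_ker_submod : submod_closed in_ker.
Proof.
split=> [|a u v]; rewrite !inE ?linear0// => /eqP fu /eqP fv.
by rewrite linearP fu fv scaler0 addr0.
Qed.

HB.instance Definition _ := GRing.isSubmodClosed.Build R U in_ker in_ker_submod.

Record ker := Ker { ker_val :> U ; _ : ker_val \in in_ker }.

HB.instance Definition _ := [isSub for ker_val].
HB.instance Definition _ := [Choice of ker by <:].
HB.instance Definition _ := [SubChoice_isSubLmodule of ker by <:].

Definition ker_incl : {linear ker -> U} := \val.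
End Kernel.

(* ker g / im f, for f : A -> B and g : B -> C; when g \o f is not zero the
   definition divides by the part of im f that lies in ker g. *)
Definition homology (R : pzRingType) (A B C : lmodType R)
    (f : {linear A -> B}) (g : {linear B -> C}) : lmodType R :=
  quo [set z : ker g | exists a : A, ker_incl g z = f a].

Section Hom.
Variables (R : comPzRingType) (U V : lmodType R).

Definition hom_module := {linear U -> V}.

Implicit Types f g h : hom_module.

HB.instance Definition _ := gen_eqMixin hom_module.
HB.instance Definition _ := gen_choiceMixin hom_module.

Lemma hom_ext f g : f =1 g -> f = g.
Proof.
case: f g => [f cf] [g cg] /= /funext fg; rewrite -{}fg in cg *.
congr GRing.Linear.Pack; case: cf cg => [[a] [b]] [[a'] [b']].
by congr GRing.Linear.Class; f_equal; apply: Prop_irrelevance.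
Qed.

Definition hom_zero : hom_module := \0.
Definition hom_add f g : hom_module := f \+ g.
Definition hom_opp f : hom_module := \- f.
Definition hom_scale (a : R) f : hom_module := a \*: f.

Lemma hom_addA : associative hom_add.
Proof. by move=> f g h; apply: hom_ext => x /=; rewrite addrA. Qed.

Lemma hom_addC : commutative hom_add.
Proof. by move=> f g; apply: hom_ext => x /=; rewrite addrC. Qed.

Lemma hom_add0 : left_id hom_zero hom_add.
Proof. by move=> f; apply: hom_ext => x /=; rewrite add0r. Qed.

Lemma hom_addN : left_inverse hom_zero hom_opp hom_add.
Proof. by move=> f; apply: hom_ext => x /=; rewrite addNr. Qed.

HB.instance Definition _ :=
  GRing.isZmodule.Build hom_module hom_addA hom_addC hom_add0 hom_addN.

Lemma hom_scaleA a b f : hom_scale a (hom_scale b f) = hom_scale (a * b) f.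
Proof. by apply: hom_ext => x /=; rewrite scalerA. Qed.

Lemma hom_scale1 : left_id 1 hom_scale.
Proof. by move=> f; apply: hom_ext => x /=; rewrite scale1r. Qed.

Lemma hom_scaleDr : right_distributive hom_scale +%R.
Proof. by move=> a f g; apply: hom_ext => x /=; rewrite scalerDr. Qed.

Lemma hom_scaleDl f : {morph hom_scale^~ f : a b / a + b}.
Proof. by move=> a b; apply: hom_ext => x /=; rewrite scalerDl. Qed.

HB.instance Definition _ := GRing.Zmodule_isLmodule.Build R hom_module
  hom_scaleA hom_scale1 hom_scaleDr hom_scaleDl.
End Hom.

Section HomMap.
Variables (R : comPzRingType) (U U' V : lmodType R) (f : {linear U -> U'}).

Definition hom_map_fun (g : hom_module U' V) : hom_module U V := g \o f.

Lemma hom_map_linear : linear hom_map_fun.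
Proof. by move=> a g h; apply: hom_ext. Qed.

HB.instance Definition _ := GRing.isLinear.Build R (hom_module U' V) (hom_module U V) *:%R
  hom_map_fun hom_map_linear.

Definition hom_map : {linear hom_module U' V -> hom_module U V} := hom_map_fun.
End HomMap.

Section Free.
Variables (R : comNzRingType) (K : choiceType).

Definition free_mod : lmodType R := {freeg K / R}.

Definition free_gen (k : K) : free_mod := << k >>.

Section Lift.
Variables (M : lmodType R) (f : K -> M).

Definition free_lift_fun (x : free_mod) : M := fglift f x.

Lemma free_lift_linear : linear free_lift_fun.
Proof.
have lD : zmod_morphism free_lift_fun by exact: lift_is_additive.
pose add := GRing.isZmodMorphism.Build free_mod M free_lift_fun lD.
pose h : {additive free_mod -> M} := HB.pack free_lift_fun add.
have lZ c x : h (c *: x) = c *: h x.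
  rewrite -[in RHS](freeg_sumE x) [c *: x]/(fgscale c x) !raddf_sum.
  by apply: eq_bigr => k _; rewrite /= /free_lift_fun !liftU scalerA.
by move=> a x y; rewrite -lZ -[RHS](raddfD h).
Qed.

HB.instance Definition _ := GRing.isLinear.Build R free_mod M *:%R free_lift_fun
  free_lift_linear.

Definition free_lift : {linear free_mod -> M} := free_lift_fun.

Lemma free_liftE k : free_lift (free_gen k) = f k.
Proof. by rewrite /= /free_lift_fun liftU scale1r. Qed.
End Lift.
End Free.

Section Tensor.
Variables (R : comNzRingType) (M N : lmodType R).

Definition tensor_rel : set (free_mod R (M * N)%type) :=
  [set z | (exists a m m' n, z = free_gen R (a *: m + m', n)
              - (a *: free_gen R (m, n) + free_gen R (m', n)))
        \/ (exists a m n n', z = free_gen R (m, a *: n + n')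
              - (a *: free_gen R (m, n) + free_gen R (m, n')))].

Definition tensor : lmodType R := quo tensor_rel.

Definition tens (m : M) (n : N) : tensor := quo_pi tensor_rel (free_gen R (m, n)).

Lemma tens_linearl n : linear (tens^~ n).
Proof.
move=> a m m'; apply/eqP; rewrite -subr_eq0 /tens -linearP -linearB.
by apply/eqP; apply/quo_pi_eq0; apply: sub_span; left; exists a, m, m', n.
Qed.

Lemma tens_linearr m : linear (tens m).
Proof.
move=> a n n'; apply/eqP; rewrite -subr_eq0 /tens -linearP -linearB.
by apply/eqP; apply/quo_pi_eq0; apply: sub_span; right; exists a, m, n, n'.
Qed.

Section Lift.
Variables (P : lmodType R) (b : M -> N -> P).
Hypotheses (bl : forall n, linear (b^~ n)) (br : forall m, linear (b m)).

Lemma tensor_lift_subproof z :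
  tensor_rel z -> free_lift (fun mn => b mn.1 mn.2) z = 0.
Proof.
by case=> -[a [x [y [t ->]]]]; rewrite linearB linearP !free_liftE /=
  ?bl ?br subrr.
Qed.

Definition tensor_lift : {linear tensor -> P} := quo_lift tensor_lift_subproof.

Lemma tensor_liftE m n : tensor_lift (tens m n) = b m n.
Proof. by rewrite [LHS]quo_liftE free_liftE. Qed.
End Lift.
End Tensor.

Section TensorMap.
Variables (R : comNzRingType) (M M' N : lmodType R) (f : {linear M -> M'}).

Lemma tensor_map_subproofl (n : N) : linear (fun m => tens (f m) n).
Proof. by move=> a m m'; rewrite linearP tens_linearl. Qed.

Lemma tensor_map_subproofr m : linear (fun n : N => tens (f m) n).
Proof. exact: tens_linearr. Qed.

Definition tensor_map : {linear tensor M N -> tensor M' N} :=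
  tensor_lift tensor_map_subproofl tensor_map_subproofr.

Lemma tensor_mapE m (n : N) : tensor_map (tens m n) = tens (f m) n.
Proof. exact: tensor_liftE. Qed.
End TensorMap.

(* The functorial free resolution of M: res M n is free on the elements of the
   n-th syzygy, where syzygy M 0 = M and syzygy M n.+1 is the kernel of the
   canonical surjection res M n -> syzygy M n. The differential out of res M 0
   is the zero map to itself, so that homology in degree 0 is the cokernel of
   res M 1 -> res M 0 (and dually for Hom). *)
Section DerivedFunctors.
Variable R : comNzRingType.
Implicit Types M N : lmodType R.

Definition cover M : {linear free_mod R M -> M} := free_lift id.

Definition syzygy M (n : nat) : lmodType R :=
  iter n (fun V : lmodType R => ker (cover V) : lmodType R) M.

Definition res M (n : nat) : lmodType R := free_mod R (syzygy M n).

Definition res_diff M (n : nat) : {linear res M n -> res M n.-1} :=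
  match n return {linear res M n -> res M n.-1} with
  | 0 => \0
  | k.+1 => ker_incl (cover (syzygy M k)) \o cover (syzygy M k.+1)
  end.

Definition Tor (n : nat) M N : lmodType R :=
  homology (tensor_map N (res_diff M n.+1)) (tensor_map N (res_diff M n)).

Definition Ext (n : nat) M N : lmodType R :=
  homology (hom_map N (res_diff M n)) (hom_map N (res_diff M n.+1)).

Definition injective_module (E : lmodType R) :=
  forall (A B : lmodType R) (i : {linear A -> B}) (f : {linear A -> E}),
    injective i -> exists g : {linear B -> E}, forall a, g (i a) = f a.

Definition finite_injdim M :=
  exists (E : nat -> lmodType R) (e : {linear M -> E 0%N})
         (d : forall n, {linear E n -> E n.+1}),
    [/\ forall n, injective_module (E n),
        injective e,
        forall x, d 0%N x = 0 <-> exists y, x = e y,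
        forall n x, d n.+1 x = 0 <-> exists y, x = d n y
      & exists r, forall n, (r < n)%N -> trivial_module (E n)].
End DerivedFunctors.

Section LocalAlgebra.
Variable R : comNzRingType.
Implicit Types (m p I : set R) (M : lmodType R).

Definition ideal I := @submodule R R^o I.

Definition noetherian :=
  forall I, ideal I -> exists s : seq R^o, I = lin_span [set` s].

Definition prime_ideal p :=
  [/\ ideal p, ~ p 1 & forall x y, p (x * y) -> p x \/ p y].

Definition maximal_ideal m :=
  [/\ ideal m, ~ m 1 & forall I, ideal I -> ~ I 1 -> m `<=` I -> I = m].

Definition local_ring m :=
  maximal_ideal m /\ forall m', maximal_ideal m' -> m' = m.

Definition prime_chain (n : nat) (c : nat -> set R) :=
  (forall i, (i <= n)%N -> prime_ideal (c i)) /\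
  (forall i, (i < n)%N -> c i `<` c i.+1).

Definition krull_dim (d : nat) :=
  (exists c : nat -> set R, prime_chain d c) /\
  (forall n (c : nat -> set R), prime_chain n c -> (n <= d)%N).

Definition residue_field m : lmodType R := @quo R R^o m.

(* The submodule (s)M, for a sequence s of ring elements. *)
Definition seq_mul M (s : seq R) : set M :=
  lin_span [set v | exists2 x, x \in s & exists u, v = x *: u].

Definition regular_seq m M (s : seq R) :=
  [/\ forall x, x \in s -> m x,
      forall k, (k < size s)%N -> forall u : M,
        seq_mul (take k s) (s`_k *: u) -> seq_mul (take k s) u
    & seq_mul s <> [set: M]].

(* In particular the zero module has no depth in nat. *)
Definition depth m M (n : nat) :=
  (exists2 s, regular_seq m M s & size s = n) /\
  (forall s, regular_seq m M s -> (size s <= n)%N).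

Definition maximal_CM m M :=
  fingen M /\ exists2 n, depth m M n & krull_dim n.

(* The type of M is the dimension of Ext^t(k, M) over the residue field k,
   where t is the depth of M. *)
Definition CM_type m M (r : nat) :=
  exists2 t, depth m M t &
    isomorphic (Ext t (residue_field m) M) {ffun 'I_r -> residue_field m}.

Definition canonical_module m (w : lmodType R) :=
  [/\ maximal_CM m w, CM_type m w 1 & finite_injdim w].

Definition canonical_dual (w N : lmodType R) : lmodType R := hom_module N w.
End LocalAlgebra.

(* Main.v *)
(** Write X = M ⊗ N† and let E be the given finite injective resolution of ω.

    Ext(-, ω) is computed on E.  Descending from the length of E, one gets
    Ext^n(A, ω) = 0 for n > d and A of finite length, because k embeds in
    R/(x), of projective dimension d, for a maximal regular sequence x; by
    Nakayama Ext^i(A, ω) = 0 for i > 0 and A maximal Cohen-Macaulay, and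
    Ext^n(A, ω) = 0 for n > d and A finitely generated.  Since Ext^d(k, ω) is
    nonzero, a finitely generated A with Ext^i(A, ω) = 0 for 1 ≤ i ≤ d is
    conversely maximal Cohen-Macaulay: if x is a maximal A-regular sequence
    of length t < d, then Ext^d(A/xA, ω) = 0 while k embeds in A/xA.

    The type being 1, ω/xω is an injective R/(x)-module with simple socle, so
    End(ω/xω) = R/(x) by Matlis duality, and End(ω) = R by Nakayama.
    Dualizing free presentations twice gives N ≅ N†† for N maximal
    Cohen-Macaulay.

    If F is the free resolution of M, then Hom(F, N) = Hom(F ⊗ N†, ω), and the
    Tor hypothesis says that F ⊗ N† is, up to degree d + 1, a resolution of X by
    Ext(-, ω)-acyclic modules.  Hence Ext^i(M, N) = Ext^i(X, ω) for
    1 ≤ i ≤ d, and both conditions of the theorem say that these vanish. *)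

(* Two models of Ext are kept apart. [exv] uses the free resolution of the first argument; it is the
   one in the statement and allows any coefficients. [van] uses [E]; its coefficients are always ω,
   and only there is finite injective dimension visible. They meet in [van_chase]. Only vanishing is
   ever needed, so long exact sequences enter as three-term pieces about cocycles.

   Depth is replaced by [deep], the vanishing of Ext^i(k, X) for i < j. It behaves well in short
   exact sequences, admits zero syzygies, and gives a sequence regular on R and X at once by way of
   R × X.

   Injectivity of ω/xω over R/(x) is obtained without changing the ring: [ext_prop] states an
   extension property for modules killed by a part of x, and each further element of x is traded for
   one Ext degree. In the end the condition on Ext concerns degree d + 1, where it always holds. *)
Require Import Defs.
From HB Require Import structures.
From mathcomp Require Import all_boot all_algebra.
From mathcomp Require Import boolp classical_sets.
From mathcomp Require Import freeg ring.

Set Implicit Arguments.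
Unset Strict Implicit.
Unset Printing Implicit Defensive.

(* [Defs] again, since vector.v has lemmas of the same names. *)
Import Defs GRing.Theory.

(* Decides equality in abelian groups by comparing the coefficients of the atoms. *)

Inductive zexp := ZVar of nat | ZAdd of zexp & zexp | ZOpp of zexp | ZZero.

Section ZmodReflection.
Local Open Scope ring_scope.
Variable V : zmodType.

Fixpoint zeval (env : seq V) e : V := match e with
  | ZVar i => env`_i
  | ZAdd a b => zeval env a + zeval env b
  | ZOpp a => - zeval env a
  | ZZero => 0 end.

Fixpoint zcoef i e : int := match e with
  | ZVar j => (i == j)%:R
  | ZAdd a b => zcoef i a + zcoef i b
  | ZOpp a => - zcoef i a
  | ZZero => 0 end.

Lemma zevalE env e : zeval env e = \sum_(i < size env) env`_i *~ zcoef i e.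
Proof.
elim: e => /= [j|a -> b ->|a ->|]; last by rewrite big1 // => i _; rewrite mulr0z.
- have [jn|nj] := ltnP j (size env).
    rewrite (bigD1 (Ordinal jn)) //= eqxx mulr1z big1 ?addr0 // => i ij.
    by rewrite -val_eqE /= in ij; rewrite (negPf ij) mulr0z.
  rewrite nth_default // big1 // => i _.
  by rewrite (ltn_eqF (leq_trans (ltn_ord i) nj)) mulr0z.
- by rewrite -big_split; apply: eq_bigr => i _; rewrite mulrzDr.
- by rewrite -sumrN; apply: eq_bigr => i _; rewrite mulrNz.
Qed.

Lemma zeval_eq env e f :
  all (fun i => zcoef i e == zcoef i f) (iota 0 (size env)) -> zeval env e = zeval env f.
Proof.
move=> /allP h; rewrite !zevalE; apply: eq_bigr => i _; congr (_ *~ _); apply/eqP.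
by apply: h; rewrite mem_iota /=.
Qed.
End ZmodReflection.

Ltac z_add a l :=
  let rec aux m := lazymatch m with
    | nil => constr:(cons a l)
    | cons ?b ?m' => match constr:(Set) with
      | _ => let _ := match constr:(Set) with _ => unify a b end in l
      | _ => aux m' end end in aux l.
Ltac z_atoms l e := lazymatch e with
  | (?a + ?b)%R => let l1 := z_atoms l a in z_atoms l1 b
  | (- ?a)%R => z_atoms l a
  | 0%R => l
  | _ => z_add e l end.
Ltac z_index a l := lazymatch l with
  | cons ?b ?m => match constr:(Set) with
    | _ => let _ := match constr:(Set) with _ => unify a b end in constr:(0%nat)
    | _ => let n := z_index a m in constr:(S n) end end.
Ltac z_reify l e := lazymatch e with
  | (?a + ?b)%R => let x := z_reify l a in let y := z_reify l b in constr:(ZAdd x y)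
  | (- ?a)%R => let x := z_reify l a in constr:(ZOpp x)
  | 0%R => constr:(ZZero)
  | _ => let n := z_index e l in constr:(ZVar n) end.
Ltac zmod := lazymatch goal with |- @eq ?T ?a ?b =>
  let l0 := z_atoms (@nil T) a in let l := z_atoms l0 b in
  let x := z_reify l a in let y := z_reify l b in
  exact (@zeval_eq _ l x y isT) end.

Ltac module := rewrite ?(GRing.scalerDr, GRing.scalerDl, GRing.scalerBr, GRing.scalerBl,
  GRing.scalerN, GRing.scaleNr, GRing.scalerA, GRing.scale1r, GRing.scaleN1r, GRing.scaler0,
  GRing.scale0r, GRing.mulrA); zmod.

(** * Linear maps *)

Section LinearMaps.
Local Open Scope ring_scope.
Variable R : comNzRingType.
Implicit Types A B C U V W : lmodType R.

Definition surj U V (f : {linear U -> V}) := forall v, exists u, f u = v.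

Lemma ex_linear U V (f : U -> V) : linear f -> exists g : {linear U -> V}, g =1 f.
Proof.
move=> lf; pose m := GRing.isLinear.Build R U V *:%R f lf.
by pose g : {linear U -> V} := HB.pack f m; exists g.
Qed.

(** The universal property of a cokernel for any surjection [s], by way of a chosen set-theoretic
    section. With the dual [linear_corestr] it builds maps out of quotients and into kernels without
    identifying modules up to isomorphism. *)
Lemma linear_factor U V W (s : {linear U -> V}) (g : {linear U -> W}) :
  surj s -> (forall u, s u = 0 -> g u = 0) ->
  exists h : {linear V -> W}, forall u, h (s u) = g u.
Proof.
move=> sS sg; have sg' u v : s u = s v -> g u = g v.
  move=> suv; apply/eqP; rewrite -subr_eq0 -linearB; apply/eqP/sg.
  by rewrite linearB suv subrr.
have [q qP] := choice sS.
have [|h hE] := @ex_linear V W (g \o q).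
  by move=> a u v /=; rewrite -linearP; apply: sg'; rewrite linearP !qP.
by exists h => u; rewrite hE; apply: sg'; rewrite qP.
Qed.

Lemma linear_corestr U V W (i : {linear V -> W}) (g : {linear U -> W}) :
  injective i -> (forall u, exists v, g u = i v) ->
  exists h : {linear U -> V}, forall u, i (h u) = g u.
Proof.
move=> iI /choice[q qP].
have [|h hE] := @ex_linear U V q.
  by move=> a u v; apply: iI; rewrite linearP -!qP linearP.
by exists h => u; rewrite hE qP.
Qed.

Lemma linear_inj U V (f : {linear U -> V}) : (forall u, f u = 0 -> u = 0) -> injective f.
Proof.
move=> f0 u v fuv; apply/eqP; rewrite -subr_eq0; apply/eqP/f0.
by rewrite linearB fuv subrr.
Qed.

Definition projective P := forall B C (p : {linear B -> C}) (g : {linear P -> C}),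
  surj p -> exists h : {linear P -> B}, forall u, p (h u) = g u.

Lemma free_sum (K : choiceType) (z : free_mod R K) :
  z = \sum_(k <- dom z) coeff k z *: free_gen R k.
Proof.
rewrite -[LHS]freeg_sumE; apply: eq_bigr => k _.
apply/eqP/freeg_eqP => l; rewrite /free_mod /free_gen coeffU.
by rewrite [RHS]coeffZ coeffU mul1r.
Qed.

Lemma free_ext (K : choiceType) V (f g : {linear free_mod R K -> V}) :
  (forall k, f (free_gen R k) = g (free_gen R k)) -> f =1 g.
Proof.
move=> fg z; rewrite (free_sum z) !linear_sum; apply: eq_bigr => k _.
by rewrite !linearZ fg.
Qed.

Lemma free_projective (K : choiceType) : projective (free_mod R K).
Proof.
move=> B C p g pS; have [q qP] := choice pS.
exists (free_lift (fun k => q (g (free_gen R k)))).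
apply: (@free_ext K C (p \o free_lift _) g) => k /=.
by rewrite [free_lift_fun _ _]free_liftE qP.
Qed.

Section FinitePower.
Variable n : nat.

Definition fpow V : lmodType R := {ffun 'I_n -> V}.

Definition fsingle_fun V (i : 'I_n) (v : V) : fpow V := [ffun j => if j == i then v else 0].

Lemma fsingle_linear V i : linear (@fsingle_fun V i).
Proof.
move=> a u v; apply/ffunP => j; rewrite !ffunE.
by case: ifP; rewrite ?scaler0 ?addr0.
Qed.

HB.instance Definition _ V i := GRing.isLinear.Build R V (fpow V) *:%R
  (@fsingle_fun V i) (@fsingle_linear V i).

Definition fsingle V i : {linear V -> fpow V} := @fsingle_fun V i.

Definition fproj_fun V (i : 'I_n) (v : fpow V) : V := v i.

Lemma fproj_linear V i : linear (@fproj_fun V i).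
Proof. by move=> a u v; rewrite /fproj_fun !ffunE. Qed.

HB.instance Definition _ V i := GRing.isLinear.Build R (fpow V) V *:%R
  (@fproj_fun V i) (@fproj_linear V i).

Definition fproj V i : {linear fpow V -> V} := @fproj_fun V i.

Lemma fpow_sum V (v : fpow V) : v = \sum_(i < n) fsingle V i (fproj V i v).
Proof.
apply/ffunP => j; rewrite sum_ffunE (bigD1 j) //= big1 ?addr0 => [|i ij].
  by rewrite /fsingle_fun ffunE eqxx.
by rewrite /fsingle_fun ffunE eq_sym (negPf ij).
Qed.

Definition fgen (i : 'I_n) : fpow R^o := fsingle R^o i 1.

Lemma fgen_sum (v : fpow R^o) : v = \sum_(i < n) (v i : R) *: fgen i.
Proof.
rewrite {1}(fpow_sum v); apply: eq_bigr => i _.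
by rewrite /fgen -linearZ /= /fproj_fun [_ *: _]mulr1.
Qed.

Lemma fpow_ext V (f g : {linear fpow R^o -> V}) :
  (forall i, f (fgen i) = g (fgen i)) -> f =1 g.
Proof.
move=> fg v; rewrite (fgen_sum v) !linear_sum; apply: eq_bigr => i _.
by rewrite !linearZ fg.
Qed.

Lemma fpow_lift V (b : 'I_n -> V) :
  exists f : {linear fpow R^o -> V}, forall i, f (fgen i) = b i.
Proof.
have [|f fE] := @ex_linear (fpow R^o) V (fun v => \sum_i (v i : R) *: b i).
  move=> a u v; rewrite scaler_sumr -big_split; apply: eq_bigr => i _ /=.
  by rewrite !ffunE scalerDl scalerA.
exists f => i; rewrite fE (bigD1 i) //= big1 ?addr0 => [|j ji].
  by rewrite ffunE eqxx scale1r.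
by rewrite ffunE (negPf ji) scale0r.
Qed.

Lemma fpow_projective : projective (fpow R^o).
Proof.
move=> B C p g pS; have [q qP] := choice pS.
have [h hE] := @fpow_lift B (fun i => q (g (fgen i))).
exists h; apply: (@fpow_ext C (p \o h) g) => i /=.
by rewrite hE qP.
Qed.
End FinitePower.

Definition ses A B C (i : {linear A -> B}) (p : {linear B -> C}) :=
  [/\ injective i, surj p & forall b, p b = 0 <-> exists a, b = i a].

Lemma ses0 A B C (i : {linear A -> B}) (p : {linear B -> C}) a : ses i p -> p (i a) = 0.
Proof. by case=> _ _ ip; apply/ip; exists a. Qed.

Lemma ses_ker B C (p : {linear B -> C}) : surj p -> ses (ker_incl p) p.
Proof.
move=> pS; split=> // [|b]; first exact: val_inj.
split=> [pb|[a ->]]; first by have bk : b \in in_ker p by [rewrite inE pb]; exists (Ker bk).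
by case: a => a /=; rewrite inE => /eqP.
Qed.

Lemma kerP B C (p : {linear B -> C}) (a : ker p) : p (ker_incl p a) = 0.
Proof. by case: a => a /=; rewrite inE => /eqP. Qed.

Lemma ex_ker B C (p : {linear B -> C}) b : p b = 0 -> exists a : ker p, b = ker_incl p a.
Proof. by move=> pb; have bk : b \in in_ker p by [rewrite inE pb]; exists (Ker bk). Qed.

Lemma ker_incl_inj B C (p : {linear B -> C}) : injective (ker_incl p).
Proof. exact: val_inj. Qed.

Lemma quo_surj V (S : set V) : surj (quo_pi S).
Proof. by elim/quotW=> x; exists x. Qed.

Lemma span_id V (S : set V) v : submodule S -> lin_span S v -> S v.
Proof. by move=> sS; apply: (span_sub sS). Qed.

Lemma ses_quo A B (i : {linear A -> B}) :
  injective i -> ses i (quo_pi [set b | exists a, b = i a]).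
Proof.
move=> iI; split=> // [|b]; first exact: quo_surj.
rewrite quo_pi_eq0; split=> [|h]; last exact: sub_span.
apply: span_id; split; first by exists 0; rewrite linear0.
by move=> a _ _ [u ->] [v ->]; exists (a *: u + v); rewrite linearP.
Qed.

Lemma cover_surj V : surj (cover V).
Proof. by move=> v; exists (free_gen R v); apply: free_liftE. Qed.

Lemma residue_exists (m : set R) (u : residue_field m) :
  exists a : R, u = quo_pi (m : set R^o) a.
Proof. by have [a <-] := @quo_surj R^o m u; exists a. Qed.

End LinearMaps.

(** * Submodules *)

Section Submodules.
Local Open Scope ring_scope.
Local Open Scope classical_set_scope.
Variable R : comNzRingType.
Implicit Types V W : lmodType R.

Lemma submodD V (S : set V) u v : submodule S -> S u -> S v -> S (u + v).
Proof. by move=> [_ SP] Su Sv; rewrite -[u]scale1r; apply: SP. Qed.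

Lemma submodZ V (S : set V) a u : submodule S -> S u -> S (a *: u).
Proof. by move=> [S0 SP] Su; rewrite -[_ *: _]addr0; apply: SP. Qed.

Lemma submodB V (S : set V) u v : submodule S -> S u -> S v -> S (u - v).
Proof. by move=> sS Su Sv; apply: submodD => //; rewrite -scaleN1r; apply: submodZ. Qed.

Lemma submod_sum V (S : set V) I (r : seq I) (P : pred I) (F : I -> V) :
  submodule S -> (forall i, P i -> S (F i)) -> S (\sum_(i <- r | P i) F i).
Proof.
by move=> sS SF; apply: big_ind => //; [case: sS | move=> u v; apply: submodD].
Qed.

Lemma span_nil V v : lin_span [set` ([::] : seq V)] v -> v = 0.
Proof.
suff: lin_span [set` ([::] : seq V)] `<=` [set 0] by apply.
by apply: span_sub => //; split=> // a u w -> ->; rewrite scaler0 addr0.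
Qed.

Lemma span_mono V (S T : set V) : S `<=` lin_span T -> lin_span S `<=` lin_span T.
Proof. by apply: span_sub; apply: span_submodule. Qed.

Lemma span_mem V (s : seq V) v : v \in s -> lin_span [set` s] v.
Proof. by move=> vs; apply: sub_span. Qed.

Lemma in_set_cons V x (s : seq V) v : [set` x :: s] v <-> v = x \/ v \in s.
Proof.
rewrite -[[set` x :: s] v]/(is_true (v \in x :: s)) in_cons.
by split=> [/orP[/eqP|]|[->|->]]; rewrite ?eqxx ?orbT; [left | right | |].
Qed.

Lemma span_cons V x (s : seq V) v :
  lin_span [set` x :: s] v <-> exists a, lin_span [set` s] (v - a *: x).
Proof.
split=> [|[a sa]].
  suff: lin_span [set` x :: s] `<=` [set w | exists a, lin_span [set` s] (w - a *: x)] by apply.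
  apply: span_sub => [|w]; first split.
  - by exists 0; rewrite scale0r subr0; apply: span0.
  - move=> a u w [b ub] [c wc]; exists (a * b + c).
    by rewrite scalerDl -scalerA opprD addrACA -scalerBr; apply: spanP.
  case/in_set_cons=> [->|ws]; first by exists 1; rewrite scale1r subrr; apply: span0.
  by exists 0; rewrite scale0r subr0; apply: sub_span.
rewrite -(subrK (a *: x) v); apply: spanD.
  by move: sa; apply: span_mono => w ws; apply: sub_span; apply/in_set_cons; right.
by apply: spanZ; apply: sub_span; apply/in_set_cons; left.
Qed.

Lemma span_cat V (s t : seq V) v :
  lin_span [set` s ++ t] v <-> exists2 u, lin_span [set` s] u & lin_span [set` t] (v - u).
Proof.
elim: s v => [|x s IH] v; first split=> [tv|[u /span_nil ->]]; rewrite ?subr0 //.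
  by exists 0; [exact: span0 | rewrite subr0].
rewrite span_cons; split=> [[a /IH[u us ut]]|[u /span_cons[a us] ut]].
  exists (u + a *: x); first by apply/span_cons; exists a; rewrite addrK.
  by rewrite opprD [- u - _]addrC addrA.
by exists a; apply/IH; exists (u - a *: x) => //; rewrite opprB addrA subrK.
Qed.

Lemma span_image V W (f : {linear V -> W}) (S : set V) (T : set W) v :
  (forall u, S u -> lin_span T (f u)) -> lin_span S v -> lin_span T (f v).
Proof.
move=> ST; suff: lin_span S `<=` [set u | lin_span T (f u)] by apply.
apply: span_sub => //; split=> [|a u w /= fu fw]; first by rewrite /= linear0; apply: span0.
by rewrite linearP; apply: spanP.
Qed.

Lemma fingenP V : fingen V <-> exists n (p : {linear fpow n R^o -> V}), surj p.
Proof.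
split=> [[s sT]|[n [p pS]]].
  exists (size s); have [p pE] := @fpow_lift R (size s) V (fun i => s`_i).
  exists p => v; have : lin_span [set` s] v by rewrite sT.
  suff: lin_span [set` s] `<=` [set w | exists u, p u = w] by apply.
  apply: span_sub; first split; first by exists 0; rewrite linear0.
    by move=> a _ _ [u <-] [w <-]; exists (a *: u + w); rewrite linearP.
  move=> w /= ws; have i_lt : (index w s < size s)%N by rewrite index_mem.
  by exists (fgen R (Ordinal i_lt)); rewrite pE nth_index.
exists [seq p (fgen R i) | i <- enum 'I_n]; apply/seteqP; split=> // v _.
have [u <-] := pS v; rewrite (fgen_sum u) linear_sum.
apply: submod_sum => [|i _]; first exact: span_submodule.
by rewrite linearZ; apply: spanZ; apply: span_mem; apply: (map_f (fun i => p (fgen R i))); rewrite mem_enum.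
Qed.

Lemma fingen_surj V W (p : {linear V -> W}) : surj p -> fingen V -> fingen W.
Proof.
move=> pS /fingenP[n [q qS]]; apply/fingenP; exists n, (p \o q) => w.
by have [v <-] := pS w; have [u <-] := qS v; exists u.
Qed.

Lemma fingen_regular : @fingen R R^o.
Proof.
exists [:: 1 : R^o]; apply/seteqP; split=> // a _.
by apply/span_cons; exists a; rewrite [_ *: _]mulr1 subrr; apply: span0.
Qed.

Lemma fingen_fpow n V : fingen V -> fingen (fpow n V).
Proof.
move=> [s sT]; exists (flatten [seq [seq fsingle V i x | x <- s] | i <- enum 'I_n]).
apply/seteqP; split=> // v _; rewrite (fpow_sum v).
apply: submod_sum => [|i _]; first exact: span_submodule.
apply: (@span_image _ _ _ [set` s]) => [u us|]; last by rewrite sT.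
apply: span_mem; apply/flattenP; exists [seq fsingle V i x | x <- s]; last exact: map_f.
by apply: (map_f (fun i => [seq fsingle V i x | x <- s])); rewrite mem_enum.
Qed.

Hypothesis noeth : noetherian R.

(** Induction on the number of generators: [J] is the ideal of coefficients of [x] in the elements
    of [S]. Lifts [t] of generators of [J], together with generators [t'] of the part of [S] inside
    the span of [s], generate [S]. *)
Lemma noeth_submod V (s : seq V) (S : set V) :
  submodule S -> S `<=` lin_span [set` s] -> exists t : seq V, S = lin_span [set` t].
Proof.
elim: s S => [|x s IH] S sS Ss.
  exists [::]; apply/seteqP; split=> // v /span_nil ->.
  by case: sS.
pose J : set R^o := [set a | exists2 v, S v & lin_span [set` s] (v - a *: x)].
have sJ : submodule J.
  split; first by exists 0; rewrite ?scale0r ?subr0; [case: sS | apply: span0].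
  move=> a b c [u Su ub] [v Sv vc]; exists (a *: u + v); first exact: sS.2.
  by rewrite scalerDl -scalerA opprD addrACA -scalerBr; apply: spanP.
have [l Jl] := noeth sJ.
have [t tS Jt] : exists2 t : seq V, [set` t] `<=` S &
    forall a : R, lin_span [set` l] a -> exists2 v, lin_span [set` t] v & lin_span [set` s] (v - a *: x).
  have: [set` l] `<=` J by rewrite Jl; apply: sub_span.
  elim: l {Jl} => [|b l IHl] lJ.
    exists [::] => // a /span_nil ->; exists 0; first exact: span0.
    by rewrite scale0r subr0; apply: span0.
  have [|t tS lt] := IHl; first by move=> a al; apply: lJ; apply/in_set_cons; right.
  have [|u Su ub] := lJ b; first by apply/in_set_cons; left.
  exists (u :: t) => [w /in_set_cons[->//|/tS//]|a /span_cons[c /lt[v vt vs]]].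
  exists (v + c *: u); first by apply/span_cons; exists c; rewrite addrK.
  have -> : v + c *: u - a *: x = v - (a - c *: b) *: x + c *: (u - b *: x).
    by rewrite -[c *: b]/(c * b); module.
  by apply: spanD => //; apply: spanZ.
rewrite -Jl in Jt; have [||t' St'] := IH [set v | S v /\ lin_span [set` s] v].
- split; first by split; [case: sS | apply: span0].
  by move=> a u v [Su su] [Sv sv]; split; [apply: sS.2 | apply: spanP].
- by move=> v [].
exists (t ++ t'); apply/seteqP; split=> v.
  move=> Sv; have /span_cons[a va] := Ss _ Sv.
  have [|w wt ws] := Jt a; first by exists v.
  apply/span_cat; exists w => //; rewrite -St'; split.
    by apply: submodB => //; apply: (span_sub sS tS).
  by have := spanD va (spanN ws); congr (lin_span _ _); zmod.
move/span_cat=> [u /(span_sub sS tS) Su]; rewrite -St' => -[Svu _].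
by rewrite -(subrK u v); apply: submodD.
Qed.

Lemma fingen_inj V W (i : {linear V -> W}) : injective i -> fingen W -> fingen V.
Proof.
move=> iI [s sT].
have [||t tE] := @noeth_submod W s [set w | exists v, w = i v].
- split; first by exists 0; rewrite linear0.
  by move=> a _ _ [u ->] [v ->]; exists (a *: u + v); rewrite linearP.
- by rewrite sT.
have /choice[q qP] : forall w, exists v, w \in t -> w = i v.
  move=> w; have [wt|_] := boolP (w \in t); last by exists 0.
  by have [v ->] : [set w | exists v, w = i v] w by [rewrite tE; apply: span_mem]; exists v.
exists (map q t); apply/seteqP; split=> // v _.
have tv : lin_span [set` t] (i v) by rewrite -tE; exists v.
have : lin_span [set` t] `<=` [set w | exists2 v, w = i v & lin_span [set` map q t] v].
  apply: span_sub; first split; first by exists 0; [rewrite linear0 | apply: span0].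
    by move=> a _ _ [u -> us] [u' -> us']; exists (a *: u + u'); [rewrite linearP | apply: spanP].
  by move=> x xt; exists (q x); [exact: qP | apply: span_mem; apply: map_f].
by move=> /(_ _ tv)[u /iI ->].
Qed.

(** A counterexample would give, by choice, a strictly increasing sequence of submodules; its union
    is finitely generated, hence reached at a finite stage. The induction passes from larger
    submodules to smaller ones. *)
Lemma noeth_ind V (P : set V -> Prop) : fingen V ->
  (forall S, submodule S -> (forall T, submodule T -> S `<` T -> P T) -> P S) ->
  forall S, submodule S -> P S.
Proof.
move=> [g gT] IH S0 sS0; apply: contrapT => nP0.
pose Bad := {S : set V | submodule S /\ ~ P S}.
have /choice[next nextP] : forall S : Bad, exists T : Bad, sval S `<` sval T.
  move=> [S [sS nPS]]; apply: contrapT => nex; apply: (nPS); apply: IH => // T sT ST.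
  apply: contrapT => nPT; apply: nex.
  by exists (exist _ T (conj sT nPT)).
pose f n := sval (iter n next (exist _ S0 (conj sS0 nP0) : Bad)).
have sf n : submodule (f n) by rewrite /f; case: (iter n next _) => S [].
have f_lt n : f n `<` f n.+1 by apply: nextP.
have f_le n k : (n <= k)%N -> f n `<=` f k.
  move=> /subnK <-; elim: (k - n)%N => // j IHj.
  by apply: subset_trans IHj _; have /properW := f_lt (j + n)%N.
have [||t tE] := @noeth_submod V g [set v | exists n, f n v].
- split; first by exists 0%N; case: (sf 0%N).
  move=> a u v [n fu] [k fv]; exists (maxn n k).
  by apply: (sf _).2; [apply: f_le fu; apply: leq_maxl | apply: f_le fv; apply: leq_maxr].
- by rewrite gT.
have [n tn] : exists n, [set` t] `<=` f n.
  have : forall v, v \in t -> exists n, f n v.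
    by move=> v vt; have : [set v | exists n, f n v] v by rewrite tE; apply: sub_span.
  elim: t {tE} => [|x t IHt] h; first by exists 0%N.
  have [|n tn] := IHt; first by move=> v vt; apply: h; rewrite inE vt orbT.
  have [|k xk] := h x; first by rewrite inE eqxx.
  exists (maxn n k) => v /in_set_cons[->|/tn vn].
    by apply: f_le xk; apply: leq_maxr.
  by apply: f_le vn; apply: leq_maxl.
have [_ nle] := f_lt n; apply: nle => v fv; apply: (span_sub (sf n) tn).
by rewrite -tE; exists n.+1.
Qed.

Lemma noeth_max V (P : set V -> Prop) S0 : fingen V -> submodule S0 -> P S0 ->
  exists S, [/\ submodule S, P S, S0 `<=` S &
    forall T, submodule T -> P T -> S `<=` T -> T = S].
Proof.
move=> fV sS0; move: S0 sS0; apply: (noeth_ind fV) => S sS IH PS.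
have [[T [sT ST PT]]|nex] := pselect (exists T, [/\ submodule T, S `<` T & P T]).
  have [M [sM PM TM maxM]] := IH T sT ST PT.
  by exists M; split=> //; apply: subset_trans TM; apply: properW.
exists S; split=> // T sT PT ST; apply: contrapT => TS; apply: nex; exists T; split=> //.
by split=> // TleS; apply: TS; apply/seteqP.
Qed.
End Submodules.

(** * Local rings *)

Section LocalRing.
Local Open Scope ring_scope.
Local Open Scope classical_set_scope.
Variables (R : comNzRingType) (m : set R).
Implicit Types V W : lmodType R.
Hypotheses (noeth : noetherian R) (locm : local_ring m).

Lemma max_ideal : ideal m. Proof. by case: locm => -[]. Qed.

Lemma max_proper : ~ m 1. Proof. by case: locm => -[]. Qed.

Lemma maxD a b : m a -> m b -> m (a + b). Proof. exact: (@submodD R R^o _ _ _ max_ideal). Qed.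

Lemma maxM a b : m b -> m (a * b). Proof. exact: (@submodZ R R^o _ a b max_ideal). Qed.

Lemma ideal_sub_max (J : set R) : ideal J -> ~ J 1 -> J `<=` m.
Proof.
move=> sJ J1.
have [M [sM M1 JM maxM]] := @noeth_max R noeth R^o (fun I => ~ I 1) J (fingen_regular R) sJ J1.
case: locm => _ /(_ M) <- //; split=> // I sI I1 MI; exact: maxM.
Qed.

Lemma local_unit a : ~ m a -> exists b, a * b = 1.
Proof.
move=> ma; apply: contrapT => nu; apply: ma.
have sJ : @submodule R R^o [set c | exists b, c = a * b].
  split; first by exists 0; rewrite mulr0.
  by move=> c _ _ [u ->] [v ->]; exists (c * u + v); rewrite mulrDr mulrCA.
apply: (ideal_sub_max sJ); first by move=> [b /esym ab]; apply: nu; exists b.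
by exists 1; rewrite mulr1.
Qed.

(** Modulo [B] the first generator satisfies u = x(cu + v) with [v] in the span of the others. As 1
    - xc is a unit with inverse [e], u = exv modulo [B], and [u] is redundant. A single [x] suffices
    because the applications divide by one regular element at a time. *)
Lemma nakayama V x (B : set V) (s : seq V) : m x -> submodule B ->
  (forall z, lin_span [set` s] z -> exists2 z', lin_span [set` s] z' & B (z - x *: z')) ->
  lin_span [set` s] `<=` B.
Proof.
move=> mx sB; elim: s => [_ v /span_nil ->|u s IH h]; first by case: sB.
have su : lin_span [set` u :: s] u by apply: span_mem; rewrite inE eqxx.
have [z /span_cons[c sz] Buz] := h u su.
have [|e ec] := @local_unit (1 - x * c).
  move=> m1; apply: max_proper; rewrite -(subrK (x * c) 1); apply: maxD => //.
  by rewrite mulrC; apply: maxM.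
set v := z - c *: u in sz.
have Bu : B (u - e *: (x *: v)).
  suff -> : u - e *: (x *: v) = e *: (u - x *: z) by apply: submodZ.
  have eu : u = e *: u - (e * x * c) *: u.
    by rewrite -scalerBl -[X in X - _]mulr1 -mulrA -mulrBr mulrC ec scale1r.
  by rewrite {1}eu /v; module.
(* Replacing [u] by exv in the witness for [w] brings the witness back into the span of [s]. *)
have sB' : lin_span [set` s] `<=` B.
  apply: IH => w sw; have [|w' /span_cons[c' sw'] Bw] := h w.
    by apply/span_cons; exists 0; rewrite scale0r subr0.
  exists (c' *: (e *: (x *: v)) + (w' - c' *: u)).
    by apply: spanD => //; do !apply: spanZ.
  have -> : w - x *: (c' *: (e *: (x *: v)) + (w' - c' *: u)) =
            (w - x *: w') + (x * c') *: (u - e *: (x *: v)).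
    by rewrite [e *: (x *: v)]scalerA; move: (e * x) => y; module.
  by apply: submodD => //; apply: submodZ.
have Bu' : B u.
  by rewrite -(subrK (e *: (x *: v)) u); apply: submodD => //; do 2!apply: submodZ => //; apply: sB'.
move=> w /span_cons[a sw]; rewrite -(subrK (a *: u) w).
by apply: submodD => //; [apply: sB' | apply: submodZ].
Qed.

Lemma nakayama_fingen V x (B : set V) : fingen V -> m x -> submodule B ->
  (forall z, exists z', B (z - x *: z')) -> forall z, B z.
Proof.
move=> [s sT] mx sB h z; have : lin_span [set` s] z by rewrite sT.
by apply: (nakayama mx sB) => u _; have [u' ?] := h u; exists u' => //; rewrite sT.
Qed.

Definition kills V (p : seq R) := forall x, x \in p -> forall v : V, x *: v = 0.

Definition soc V (u : V) := forall a, m a -> a *: u = 0.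

Notation k := (residue_field m).

Definition kone : k := quo_pi (m : set R^o) (1 : R^o).

Lemma residueE a : quo_pi (m : set R^o) a = a *: kone.
Proof. by rewrite /kone -linearZ /= [_ *: _]mulr1. Qed.

Lemma residue_eq0 a : a *: kone = 0 <-> m a.
Proof.
rewrite -residueE quo_pi_eq0; split=> [|ma]; first exact: (span_id max_ideal).
exact: sub_span.
Qed.

Lemma residueP (u : k) : exists a, u = a *: kone.
Proof. by have [a ->] := residue_exists u; exists a; rewrite residueE. Qed.

Lemma soc_residue (u : k) : soc u.
Proof. by move=> a ma; have [b ->] := residueP u; rewrite scalerA mulrC -scalerA (residue_eq0 _).2 ?scaler0. Qed.

Lemma soc_map V (u : V) : soc u -> u <> 0 ->
  exists2 f : {linear k -> V}, injective f & f kone = u.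
Proof.
move=> su u0.
have [|g gE] := @ex_linear R R^o V (fun a : R => a *: u).
  by move=> a b c /=; rewrite scalerDl -scalerA.
have gm : forall a : R^o, m a -> g a = 0 by move=> a ma; rewrite gE su.
have fE a : quo_lift gm (a *: kone) = a *: u by rewrite -residueE quo_liftE gE.
exists (quo_lift gm); last by rewrite -{1}[kone]scale1r fE scale1r.
apply: linear_inj => v; have [a ->] := residueP v; rewrite fE => au.
apply/residue_eq0; apply: contrapT => /local_unit[b ab]; apply: u0.
by rewrite -[u]scale1r -ab mulrC -scalerA au scaler0.
Qed.

(* A maximal proper submodule has quotient k. *)
Lemma map_to_residue V : fingen V -> ~ trivial_module V ->
  exists f : {linear V -> k}, surj f.
Proof.
move=> fV /existsNP[v v0].
have [s sT] := fV.
have [||S [sS pS _ maxS]] := @noeth_max R noeth V (fun S => ~ forall v, S v) [set 0] fV.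
- by split=> // a x y -> ->; rewrite scaler0 addr0.
- by move=> /(_ v).
move/existsNP: pS => [u Su].
have Su' w : exists a, S (w - a *: u).
  apply: contrapT => nw.
  have sT' : submodule [set w | exists a, S (w - a *: u)].
    split; first by exists 0; rewrite scale0r subr0; case: sS.
    move=> a x y [b xb] [c yc]; exists (a * b + c).
    by rewrite scalerDl -scalerA opprD addrACA -scalerBr; apply: sS.2.
  have ST' : S `<=` [set w | exists a, S (w - a *: u)].
    by move=> x Sx; exists 0; rewrite scale0r subr0.
  have TS := maxS _ sT' (fun h => nw (h w)) ST'.
  by apply: Su; rewrite -TS; exists 1; rewrite scale1r subrr; case: sS.
have sJ : @submodule R R^o [set a | S (a *: u)].
  split; first by rewrite /= scale0r; case: sS.
  by move=> a b c /= Sb Sc; rewrite scalerDl -scalerA; apply: sS.2.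
have Jm : [set a | S (a *: u)] `<=` m by apply: ideal_sub_max => //=; rewrite scale1r.
have mJ a : m a -> S (a *: u).
  move=> ma; apply: contrapT => Sa;
  have [c cS] : exists c, S (u - c *: (a *: u)).
    apply: contrapT => nc.
    have sT' : submodule [set w | exists c, S (w - c *: (a *: u))].
      split; first by exists 0; rewrite scale0r subr0; case: sS.
      move=> e x y [b xb] [c yc]; exists (e * b + c).
      by rewrite scalerDl -scalerA opprD addrACA -scalerBr; apply: sS.2.
    have ST' : S `<=` [set w | exists c, S (w - c *: (a *: u))].
      by move=> x Sx; exists 0; rewrite scale0r subr0.
    have TS := maxS _ sT' (fun h => nc (h u)) ST'.
    by apply: Sa; rewrite -TS; exists 1; rewrite scale1r subrr; case: sS.
  have /Jm m1 : S ((1 - c * a) *: u) by rewrite scalerBl scale1r -scalerA.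
  by case: max_proper; rewrite -(subrK (c * a) 1); apply: maxD => //; apply: maxM.
have [q qP] := choice Su'.
have [|f fE] := @ex_linear R V k (fun w => q w *: kone).
  move=> a x y; rewrite scalerA -scalerDl; apply/eqP; rewrite -subr_eq0 -scalerBl; apply/eqP/residue_eq0/Jm.
  rewrite /= scalerBl scalerDl -scalerA.
  have -> : q (a *: x + y) *: u - (a *: (q x *: u) + q y *: u) =
    (a *: (x - q x *: u) + (y - q y *: u)) - ((a *: x + y) - q (a *: x + y) *: u).
    module.
  by apply: submodB => //; apply: sS.2.
exists f => z; have [a ->] := residueP z; exists (a *: u); rewrite fE.
apply/eqP; rewrite -subr_eq0 -scalerBl; apply/eqP/residue_eq0/Jm.
by rewrite /= scalerBl -opprB -scaleN1r; apply: submodZ.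
Qed.

End LocalRing.

(** * Regular sequences *)

Section RegularElement.
Local Open Scope ring_scope.
Local Open Scope classical_set_scope.
Variables (R : comNzRingType) (m : set R).
Hypotheses (noeth : noetherian R) (locm : local_ring m).
Variable V : lmodType R.
Hypothesis fV : fingen V.

(** The annihilator of such a [u] is maximal among those of nonzero elements, hence an associated
    prime of [V]; primes are handled through elements that they annihilate. *)
Definition max_ann (u : V) := u <> 0 /\
  forall v : V, v <> 0 -> (forall a : R, a *: u = 0 -> a *: v = 0) ->
  forall a : R, a *: v = 0 -> a *: u = 0.

Lemma max_ann_exists (v : V) : v <> 0 ->
  exists2 u, max_ann u & forall a : R, a *: v = 0 -> a *: u = 0.
Proof.
move=> v0; pose ann (w : V) : set R^o := [set a | a *: w = 0].
have sann w : submodule (ann w).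
  split=> [|a b c /= bw cw]; rewrite /ann /= ?scale0r //.
  by rewrite scalerDl -scalerA bw cw scaler0 addr0.
have [|_ [_ [u u0 ->] vu maxu]] := @noeth_max R noeth R^o (fun J => exists2 w, w <> 0 & J = ann w)
  (ann v) (fingen_regular R) (sann v); first by exists v.
exists u => [|a /vu //]; split=> // w w0 uw a aw.
have wu : ann w = ann u by apply: maxu => //; exists w.
by have : ann w a by []; rewrite wu.
Qed.

(** If bu is nonzero, its annihilator contains that of [u], so maximality makes them equal. *)
Lemma max_ann_prime (u : V) (a b : R) : max_ann u -> a *: u <> 0 -> b *: u <> 0 -> (a * b) *: u <> 0.
Proof.
move=> [u0 maxu] au bu abu; apply: bu; apply: (maxu (a *: u)) => // [c cu|].
  by rewrite scalerA mulrC -scalerA cu scaler0.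
by rewrite scalerA mulrC.
Qed.

Lemma max_ann_separate (u : V) (t : seq V) : max_ann u ->
  (forall w, w \in t -> exists2 y : R, y *: w = 0 & y *: u <> 0) ->
  exists2 y : R, forall w, w \in t -> y *: w = 0 & y *: u <> 0.
Proof.
move=> mu; elim: t => [|w t IH] h; first by exists 1; rewrite ?scale1r //; case: mu.
have [|y yt yu] := IH; first by move=> v vt; apply: h; rewrite inE vt orbT.
have [|z zw zu] := h w; first by rewrite inE eqxx.
exists (y * z) => [v|]; last exact: max_ann_prime.
rewrite inE => /orP[/eqP ->|/yt yv]; first by rewrite -scalerA zw scaler0.
by rewrite mulrC -scalerA yv scaler0.
Qed.

(** Stands in for the finiteness of the set of associated primes: a scalar that kills [t] kills
    every such [u], so by [max_ann_separate] the annihilator of [u] contains that of some member of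
    [t]. *)
Lemma max_ann_finite : exists2 t : seq V, forall u, u \in t -> max_ann u &
  forall u, max_ann u -> lin_span [set` t] u.
Proof.
pose P S := exists2 t : seq V, forall u, u \in t -> max_ann u & S = lin_span [set` t].
have [|_ [_ [t tm ->] _ maxt]] := @noeth_max R noeth V P (lin_span [set` [::]]) fV (@span_submodule _ _ _).
  by exists [::].
exists t => // u mu; rewrite -(maxt (lin_span [set` u :: t])).
- by apply: span_mem; rewrite inE eqxx.
- exact: span_submodule.
- by exists (u :: t) => // v; rewrite inE => /orP[/eqP ->|/tm].
- by apply: span_mono => v vt; apply: span_mem; rewrite inE [v \in t]vt orbT.
Qed.

(* Every zero divisor kills an element with maximal annihilator, and these
   annihilators are finitely many primes, so prime avoidance applies. *)
Lemma exists_regular : (forall u : V, soc m u -> u = 0) ->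
  exists2 x, m x & forall v : V, x *: v = 0 -> v = 0.
Proof.
move=> nosoc; have [t tm tspan] := max_ann_finite.
have [x mx xt] : exists2 x, m x & forall u, u \in t -> x *: u <> 0.
  elim: t tm {tspan} => [|u t IH] tm; first by exists 0 => //; case: (max_ideal locm).
  have mu : max_ann u by apply: tm; rewrite inE eqxx.
  have [|x mx xt] := IH; first by move=> v vt; apply: tm; rewrite inE vt orbT.
  have [xu|xu] := pselect (x *: u = 0); last first.
    by exists x => // v; rewrite inE => /orP[/eqP ->|/xt].
  have [|y yt yu] := @max_ann_separate u t mu.
    move=> w wt; apply: contrapT => nsep; apply: (xt w wt).
    have [|w0 maxw] := tm w; first by rewrite inE wt orbT.
    apply: (maxw u) => //; first by case: mu.
    by move=> a aw; apply: contrapT => au; apply: nsep; exists a.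
  have [z mz zu] : exists2 z, m z & z *: u <> 0.
    apply: contrapT => nz; case: mu => u0 _; apply: u0; apply: nosoc => a ma.
    by apply: contrapT => au; apply: nz; exists a.
  exists (x + z * y) => [|v]; first by apply: maxD => //; rewrite mulrC; apply: maxM.
  rewrite inE scalerDl => /orP[/eqP ->|vt]; first by rewrite xu add0r; apply: max_ann_prime.
  by rewrite -scalerA yt // scaler0 addr0; apply: xt.
exists x => // v xv; apply: contrapT => /max_ann_exists[u mu vu].
have ut := tspan u mu.
have [|y yt yu] := @max_ann_separate u t mu.
  move=> w wt; apply: contrapT => nsep; apply: (xt w wt).
  have [w0 maxw] := tm w wt; apply: (maxw u) => //; [by case: mu | | exact: vu].
  by move=> a aw; apply: contrapT => au; apply: nsep; exists a.
apply: yu; suff: lin_span [set` t] `<=` [set w | y *: w = 0] by apply.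
apply: span_sub => //; split=> [|a w w' /= yw yw']; first by rewrite /= scaler0.
by rewrite scalerDr scalerA mulrC -scalerA yw yw' scaler0 addr0.
Qed.
End RegularElement.

Section RegularSequences.
Local Open Scope ring_scope.
Local Open Scope classical_set_scope.
Variable R : comNzRingType.
Implicit Types U V W : lmodType R.

Definition mquo (x : R) V : lmodType R := quo [set v : V | exists u, v = x *: u].

Definition mpi (x : R) V : {linear V -> mquo x V} := quo_pi [set v : V | exists u, v = x *: u].

Lemma mpi_surj x V : surj (mpi x V).
Proof. exact: quo_surj. Qed.

Lemma mpi_eq0 x V (v : V) : mpi x V v = 0 <-> exists u, v = x *: u.
Proof.
rewrite quo_pi_eq0; split=> [|h]; last exact: sub_span.
apply: span_id; split; first by exists 0; rewrite scaler0.
by move=> a _ _ [u ->] [w ->]; exists (a *: u + w); rewrite scalerDr !scalerA mulrC.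
Qed.

Lemma mpi_eq x V (v w : V) : mpi x V v = mpi x V w <-> exists u, v - w = x *: u.
Proof.
rewrite -mpi_eq0 linearB; split=> [->|/eqP]; first by rewrite subrr.
by rewrite subr_eq0 => /eqP.
Qed.

Lemma mpi_scale x V (v : V) : mpi x V (x *: v) = 0.
Proof. by apply/mpi_eq0; exists v. Qed.

Lemma mquo_kill x V (v : mquo x V) : x *: v = 0.
Proof. by have [u <-] := mpi_surj v; rewrite -linearZ mpi_scale. Qed.

Definition sreg (x : R) V := forall v : V, x *: v = 0 -> v = 0.

Lemma sreg_inj x V (v w : V) : sreg x V -> x *: v = x *: w -> v = w.
Proof.
move=> rx vw; apply/eqP; rewrite -subr_eq0; apply/eqP/rx.
by rewrite scalerBr vw subrr.
Qed.

(** This is V/(s)V, formed one element at a time to suit inductions along a regular sequence;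
    [qpi_eq0] identifies the kernel of [qpi] with [seq_mul s]. *)
Fixpoint qs V (s : seq R) : lmodType R :=
  if s is x :: s' then qs (mquo x V) s' else V.

Fixpoint qpi V (s : seq R) : {linear V -> qs V s} :=
  match s return {linear V -> qs V s} with
  | [::] => idfun
  | x :: s' => qpi (mquo x V) s' \o mpi x V end.

Lemma qpi_surj V s : surj (qpi V s).
Proof.
elim: s V => [|x s IH] V v; first by exists v.
by have [w <-] := IH _ v; have [u <-] := mpi_surj w; exists u.
Qed.

Lemma seq_mul_nil V (u : V) : seq_mul [::] u <-> u = 0.
Proof.
split=> [|->]; last exact: span0.
suff: @seq_mul _ V [::] `<=` [set 0] by apply.
by apply: span_sub => [|v [x]//]; split=> // a v w -> ->; rewrite scaler0 addr0.
Qed.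

Lemma seq_mul_map U V (f : {linear U -> V}) s u : seq_mul s u -> seq_mul s (f u).
Proof.
apply: span_image => _ [x xs [w ->]]; apply: sub_span; exists x => //.
by exists (f w); rewrite linearZ.
Qed.

Lemma seq_mul_cons V x s (u : V) : seq_mul (x :: s) u <-> seq_mul s (mpi x V u).
Proof.
split=> [|su].
  apply: span_image => v [y]; rewrite inE => /orP[/eqP ->|ys] [w ->].
    by rewrite mpi_scale; apply: span0.
  by apply: sub_span; exists y => //; exists (mpi x V w); rewrite linearZ.
have sx w : seq_mul (x :: s) (x *: w : V).
  by apply: sub_span; exists x; [rewrite inE eqxx | exists w].
(* Quantifying over all lifts [w] of [t] turns the claim into a submodule of V/xV. *)
suff: @seq_mul _ (mquo x V) s `<=` [set t | forall w, mpi x V w = t -> seq_mul (x :: s) w] by move=> /(_ _ su); apply.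
apply: span_sub => [|_ [y ys [t ->]] w]; first split=> [w /mpi_eq0[v ->]//|a t t' st st' w].
  have [v vt] := mpi_surj t; have [v' vt'] := mpi_surj t'.
  rewrite -vt -vt' -linearP => /mpi_eq[v'' ww].
  rewrite -(subrK (a *: v + v') w) ww; apply: spanD; first exact: sx.
  exact: (spanP a (st _ vt) (st' _ vt')).
have [v <-] := mpi_surj t; rewrite -linearZ => /mpi_eq[v' wv].
rewrite -(subrK (y *: v) w) wv; apply: spanD; first exact: sx.
apply: sub_span.
by exists y; [rewrite inE ys orbT | exists v].
Qed.

Lemma qpi_eq0 V s (u : V) : qpi V s u = 0 <-> seq_mul s u.
Proof.
elim: s V u => [|x s IH] V u; first by rewrite seq_mul_nil.
by rewrite seq_mul_cons -IH.
Qed.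

(** The middle clause of [regular_seq] alone. Zero modules satisfy it, and it passes to retracts and
    to sums. *)
Definition wreg V (s : seq R) := forall k, (k < size s)%N -> forall u : V,
  seq_mul (take k s) (s`_k *: u) -> seq_mul (take k s) u.

Lemma wreg_cons V x s : wreg V (x :: s) <-> sreg x V /\ wreg (mquo x V) s.
Proof.
split=> [rs|[rx rs] [_ u|k ks u]].
- split=> [u xu|k ks v].
    apply/seq_mul_nil; have := rs 0%N isT u; rewrite take0 /= xu; apply.
    exact: span0.
  have [u <-] := mpi_surj v; rewrite -linearZ => /seq_mul_cons h.
  by apply/seq_mul_cons; apply: (rs k.+1).
- by move=> /seq_mul_nil /rx ->; apply: span0.
- by rewrite /= => /seq_mul_cons; rewrite linearZ => h; apply/seq_mul_cons; exact: rs h.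
Qed.

Lemma wreg_take V s n : wreg V s -> wreg V (take n s).
Proof.
elim: s n V => [|x s IH] [|n] V // /wreg_cons[rx rs].
by apply/wreg_cons; split=> //; apply: IH.
Qed.

Lemma wreg_cat V s t : wreg V (s ++ t) -> wreg V s /\ wreg (qs V s) t.
Proof.
elim: s V => [|x s IH] V //= /wreg_cons[rx /IH[rs rt]].
by split=> //; apply/wreg_cons.
Qed.

Lemma wreg_sum V (I : Type) (U : I -> lmodType R) (pr : forall i, {linear V -> U i})
    (inj : forall i, {linear U i -> V}) s :
  (forall v, exists l : seq I, v = \sum_(i <- l) inj i (pr i v)) ->
  (forall i, wreg (U i) s) -> wreg V s.
Proof.
move=> Vsum rU k ks u su; have [l ->] := Vsum u.
apply: submod_sum => [|i _]; first exact: span_submodule.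
apply: seq_mul_map; apply: rU => //; rewrite -linearZ; exact: seq_mul_map.
Qed.

Lemma wreg_retract U V (i : {linear U -> V}) (p : {linear V -> U}) s :
  cancel i p -> wreg V s -> wreg U s.
Proof.
move=> ip rV k ks u su; rewrite -(ip u); apply: seq_mul_map; apply: rV => //.
by rewrite -linearZ; apply: seq_mul_map.
Qed.

Lemma wreg_free (K : choiceType) s : wreg R^o s -> wreg (free_mod R K) s.
Proof.
move=> rs.
have /choice[pr prE] : forall k : K, exists f : {linear free_mod R K -> R^o}, f =1 coeff k.
  move=> k; apply: ex_linear => a u v.
  by rewrite [LHS]coeffD coeffZ.
have /choice[inj injE] : forall k : K, exists f : {linear R^o -> free_mod R K}, forall a, f a = a *: free_gen R k.
  by move=> k; apply: ex_linear => a b c /=; rewrite scalerDl scalerA.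
apply: (wreg_sum (pr := pr) (inj := inj)) => // z; exists (dom z).
by rewrite [LHS]free_sum; apply: eq_bigr => k _; rewrite injE prE.
Qed.

Lemma kills_qs V p s : kills V p -> kills (qs V s) (p ++ s).
Proof.
elim: s V p => [|x s IH] V p kp; first by rewrite cats0.
rewrite -cat_rcons; apply: IH => y; rewrite mem_rcons inE => /orP[/eqP -> v|yp v].
  exact: mquo_kill.
by have [u <-] := mpi_surj v; rewrite -linearZ kp // linear0.
Qed.

Lemma kills_seq_mul V s (v : V) : kills V s -> seq_mul s v -> v = 0.
Proof.
move=> ks; suff: @seq_mul _ V s `<=` [set 0] by apply.
by apply: span_sub => [|_ [x xs [u ->]]]; [split=> // a v' w -> ->; rewrite scaler0 addr0 | exact: ks].
Qed.

Lemma kills_surj U V (p : {linear U -> V}) s : surj p -> kills U s -> kills V s.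
Proof. by move=> pS ks x xs v; have [u <-] := pS v; rewrite -linearZ ks // linear0. Qed.

Lemma kills_inj U V (i : {linear U -> V}) s : injective i -> kills V s -> kills U s.
Proof. by move=> iI ks x xs u; apply: iI; rewrite linearZ /= ks // linear0. Qed.

Lemma qs_lift V W s (g : {linear V -> W}) : kills W s ->
  exists h : {linear qs V s -> W}, forall v, h (qpi V s v) = g v.
Proof.
move=> ks; apply: linear_factor; first exact: qpi_surj.
by move=> v /qpi_eq0 sv; apply: kills_seq_mul ks _; apply: seq_mul_map.
Qed.
End RegularSequences.

(** * Ext and depth *)

Section Resolution.
Local Open Scope ring_scope.
Local Open Scope classical_set_scope.
Variable R : comNzRingType.
Implicit Types A B C U V W X Y Z : lmodType R.

Lemma homology_trivial A B C (f : {linear A -> B}) (g : {linear B -> C}) :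
  trivial_module (homology f g) <->
  (forall b, g b = 0 -> (exists a, b = f a)).
Proof.
split=> [H b /ex_ker[z ->]|H v].
  have /quo_pi_eq0 := H (quo_pi _ z).
  apply: (@span_id _ _ [set z : ker g | exists a, ker_incl g z = f a]).
  split; first by exists 0; rewrite linear0.
  by move=> a x y [u xu] [v yv]; exists (a *: u + v); rewrite !linearP xu yv.
have [z <-] := quo_surj v; apply/quo_pi_eq0; apply: sub_span.
exact: (H _ (kerP z)).
Qed.

(** Vanishing of Ext^i(A, X) on cochains. In degree 0 the map [res_diff A 0] is zero, so every
    cocycle has to be zero, which is Hom(A, X) = 0. *)
Definition exv i A X := forall f : {linear res A i -> X},
  (forall z, f (res_diff A i.+1 z) = 0) ->
  exists g : {linear res A i.-1 -> X}, forall z, f z = g (res_diff A i z).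

Lemma Ext_trivial i A X : trivial_module (Ext i A X) <-> exv i A X.
Proof.
rewrite homology_trivial; split=> H f fd.
  have [|g ->] := H f; first exact: hom_ext.
  by exists g.
have [|g fg] := H f; first by move=> z; move/(congr1 (fun h : hom_module _ _ => h z)): fd.
by exists g; apply: hom_ext.
Qed.

Lemma cover_ker A i y : cover (syzygy A i) y = 0 -> exists z, y = res_diff A i.+1 z.
Proof.
move=> /ex_ker[z ->]; have [t <-] := @cover_surj _ (syzygy A i.+1) z.
by exists t.
Qed.

Lemma cover_diff A i z : cover (syzygy A i) (res_diff A i.+1 z) = 0.
Proof. exact: kerP. Qed.

Lemma diff_diff A i z : res_diff A i (res_diff A i.+1 z) = 0.
Proof.
case: i z => [|i] z //.
rewrite -[LHS]/(ker_incl (cover (syzygy A i)) (cover (syzygy A i.+1) (res_diff A i.+2 z))).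
by rewrite cover_diff linear0.
Qed.

Lemma cocycle_factor A i X (f : {linear res A i -> X}) :
  (forall z, f (res_diff A i.+1 z) = 0) ->
  exists g : {linear syzygy A i -> X}, forall z, g (cover _ z) = f z.
Proof.
move=> fd; apply: linear_factor; first exact: cover_surj.
by move=> u /cover_ker[z ->].
Qed.

Definition mulby (x : R) V : {linear V -> V} := x \*: idfun.

Lemma mulbyE x V v : mulby x V v = x *: v. Proof. by []. Qed.

Lemma ses_mul x V : sreg x V -> ses (mulby x V) (mpi x V).
Proof.
move=> rx; split; [exact: linear_inj | exact: mpi_surj | exact: mpi_eq0].
Qed.

Lemma res_projective A i : projective (res A i).
Proof. exact: free_projective. Qed.

(** Exactness of Ext^{i-1}(A, Z) → Ext^i(A, X) → Ext^i(A, Y). The premise on [Z] is guarded because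
    in degree 0 the second map is injective. *)
Lemma exv_sub X Y Z (j : {linear X -> Y}) (p : {linear Y -> Z}) i A :
  ses j p -> ((0 < i)%N -> exv i.-1 A Z) -> exv i A Y -> exv i A X.
Proof.
move=> jp eZ eY f fd; have [jI pS pK] := jp.
have [|g gE] := eY (j \o f); first by move=> z /=; rewrite fd linear0.
case: i f fd eZ eY g gE => [|i] f fd eZ eY g gE.
  by exists \0 => z; apply: jI; rewrite [LHS]gE linear0 linear0.
have [|h hE] := eZ isT (p \o g).
  by move=> z /=; have /= <- := gE z; apply: ses0 jp.
have [h' h'E] := res_projective h pS.
have [|g' g'E] := @linear_corestr R (res A i) X Y j (g \- (h' \o res_diff A i)) jI.
  by move=> z; apply/pK; rewrite linearB [p (g z)]hE /= h'E subrr.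
exists g' => z; apply: jI; rewrite g'E /=.
by have /= -> := gE z; rewrite diff_diff linear0 subr0.
Qed.

(** Exactness of Ext^i(A, Y) → Ext^i(A, Z) → Ext^{i+1}(A, X); [g] is the image of [f] under the
    connecting map. *)
Lemma exv_quo X Y Z (j : {linear X -> Y}) (p : {linear Y -> Z}) i A :
  ses j p -> exv i A Y -> exv i.+1 A X -> exv i A Z.
Proof.
move=> jp eY eX f fd; have [jI pS pK] := jp.
have [f' f'E] := res_projective f pS.
have [|g gE] := @linear_corestr R _ X Y j (f' \o res_diff A i.+1) jI.
  by move=> z; apply/pK; rewrite /= f'E fd.
have [|h hE] := eX g.
  by move=> z; apply: jI; rewrite gE linear0 -[RHS](linear0 f'); congr (f' _); exact: (@diff_diff A i.+1 z).
have [|l lE] := eY (f' \- (j \o h)).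
  by move=> z /=; have /= <- := gE z; rewrite hE subrr.
exists (p \o l) => z /=; have /= <- := lE z.
by rewrite linearB f'E (ses0 _ jp) subr0.
Qed.

Lemma exv_pair i A X Y : exv i A X -> exv i A Y -> exv i A (X * Y)%type.
Proof.
move=> eX eY f fd.
have [|g gE] := eX (fst \o f); first by move=> z; exact: (congr1 fst (fd z)).
have [|h hE] := eY (snd \o f); first by move=> z; exact: (congr1 snd (fd z)).
have [|l lE] := @ex_linear R (res A i.-1) (X * Y)%type (fun z => (g z, h z)).
  by move=> a u v; rewrite !linearP.
by exists l => z; rewrite lE -gE -hE /=; case: (f z).
Qed.

Lemma exv_sum i A n X Y (pr : 'I_n -> {linear Y -> X}) (inj : 'I_n -> {linear X -> Y}) :
  (forall v, v = \sum_i inj i (pr i v)) -> exv i A X -> exv i A Y.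
Proof.
move=> Ysum eX f fd.
have /choice[g gE] : forall k, exists g : {linear res A i.-1 -> X},
    forall z, pr k (f z) = g (res_diff A i z).
  by move=> k; apply: (eX (pr k \o f)) => z /=; rewrite fd linear0.
have [|h hE] := @ex_linear R (res A i.-1) Y (fun z => \sum_k inj k (g k z)).
  move=> a u v; rewrite scaler_sumr -big_split; apply: eq_bigr => k _.
  by rewrite !linearP.
by exists h => z; rewrite hE {1}[f z]Ysum; apply: eq_bigr => k _; rewrite gE.
Qed.

Section Annihilator.
Variables (A : lmodType R) (x : R).
Hypothesis xA : forall v : A, x *: v = 0.

(* Multiplication by x is null-homotopic on the resolution of A. *)
Lemma scale_lift i : exists s : {linear syzygy A i -> res A i},
  forall v, cover _ (s v) = x *: v.
Proof.
elim: i => [|i [s sE]]; first by exists \0 => v; rewrite linear0 [RHS]xA.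
have [|t tE] := @linear_corestr R (res A i) (syzygy A i.+1) (res A i)
   (ker_incl (cover (syzygy A i))) (mulby x _ \- (s \o cover _)) (@ker_incl_inj _ _ _ _).
  by move=> v; apply: ex_ker; rewrite linearB linearZ [X in _ - X](sE (cover _ v)) subrr.
have [t' t'E] := res_projective t (@cover_surj R (syzygy A i.+1)).
exists (t' \o ker_incl (cover (syzygy A i))) => v.
rewrite /= [LHS]t'E; apply: (@ker_incl_inj _ _ _ (cover (syzygy A i))).
by rewrite tE linearZ /= [free_lift_fun _ _]kerP linear0 subr0.
Qed.

(** The map [t], multiplication by [x] corrected by the homotopy, has values in the syzygy on which
    the cocycle lives as [f']. On boundaries the correction vanishes, so xf is f't composed with the
    differential. *)
Lemma exv_scale i X (f : {linear res A i -> X}) :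
  (forall z, f (res_diff A i.+1 z) = 0) ->
  exists g : {linear res A i.-1 -> X}, forall z, x *: f z = g (res_diff A i z).
Proof.
move=> /cocycle_factor[f' f'E]; case: i f f' f'E => [|i] f f' f'E.
  by exists \0 => z; rewrite linear0 -f'E -linearZ [x *: cover _ _]xA linear0.
have [s sE] := scale_lift i.
have [|t tE] := @linear_corestr R (res A i) (syzygy A i.+1) (res A i)
   (ker_incl (cover (syzygy A i))) (mulby x _ \- (s \o cover _)) (@ker_incl_inj _ _ _ _).
  by move=> v; apply: ex_ker; rewrite linearB linearZ [X in _ - X](sE (cover _ v)) subrr.
exists (f' \o t) => z; rewrite -f'E -linearZ; congr (f' _).
apply: (@ker_incl_inj _ _ _ (cover (syzygy A i))); rewrite tE linearZ.
by rewrite -[RHS]/(x *: res_diff A i.+1 z - s (cover _ (res_diff A i.+1 z))) cover_diff linear0 subr0.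
Qed.
End Annihilator.
End Resolution.

Section Depth.
Local Open Scope ring_scope.
Local Open Scope classical_set_scope.
Variables (R : comNzRingType) (m : set R).
Implicit Types U V W X Y Z : lmodType R.
Hypotheses (noeth : noetherian R) (locm : local_ring m).
Notation k := (residue_field m).

(** For nonzero finitely generated [X] this means depth at least [j]. The zero module, a possible
    syzygy, satisfies it for every [j]. *)
Definition deep j X := forall i, (i < j)%N -> exv i k X.

Lemma deepW j l X : (j <= l)%N -> deep l X -> deep j X.
Proof. by move=> jl dX i ij; apply: dX; apply: leq_trans ij jl. Qed.

(** Since [x] kills k, xf is a coboundary gd. Modulo [x], [g] is a cocycle one degree lower, hence a
    coboundary by induction; after a correction by it [g] is divisible by [x], and [x] cancels. *)
Lemma deep_wreg V s : (forall x, x \in s -> m x) -> wreg V s -> deep (size s) V.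
Proof.
elim: s V => [|x s IH] V sm // /wreg_cons[rx rs] i i_lt f fd.
have xk (v : k) : x *: v = 0 by apply: soc_residue => //; apply: sm; rewrite inE eqxx.
have [g gE] := exv_scale xk fd.
case: i i_lt f fd g gE => [|i] i_lt f fd g gE.
  by exists \0 => z; apply: rx; rewrite gE linear0.
have [|//|z|h hE] := IH (mquo x V) _ rs i _ (mpi x V \o g).
- by move=> y ys; apply: sm; rewrite inE ys orbT.
- by rewrite /=; have /= <- := gE z; rewrite mpi_scale.
have [h' h'E] := res_projective h (@mpi_surj R x V).
have [||g' g'E] := @linear_corestr R _ V V (mulby x V) (g \- (h' \o res_diff k i)).
- by apply: linear_inj.
- by move=> z; apply/mpi_eq0; rewrite linearB [mpi x V (g z)]hE /= h'E subrr.
exists g' => z; apply: (sreg_inj rx); rewrite gE -mulbyE g'E /=.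
by rewrite diff_diff linear0 subr0.
Qed.

Lemma deep_mquo j x V : sreg x V -> deep j.+1 V -> deep j (mquo x V).
Proof.
move=> rx dV i ij; apply: exv_quo (ses_mul rx) _ _; apply: dV => //.
exact: ltnW.
Qed.

Lemma deep_nosoc j V (u : V) : deep j.+1 V -> soc m u -> u = 0.
Proof.
move=> dV su; apply: contrapT => u0.
have [f fI fu] := soc_map noeth locm su u0.
have [//||g gE] := dV 0%N _ (f \o cover k).
  by move=> z; rewrite -[RHS](linear0 f); congr (f _); exact: (@cover_diff R k 0 z).
apply: u0; rewrite -fu -[kone m](@free_liftE R k k id).
by rewrite [LHS]gE [res_diff _ _ _]/= linear0.
Qed.

(** Hom(k, V) = 0 excludes a socle, so a regular element exists, and dividing by it costs one
    degree. For a product the resulting sequence is regular on both factors. *)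
Lemma deep_seq j V : fingen V -> deep j V ->
  exists s, [/\ size s = j, forall x, x \in s -> m x & wreg V s].
Proof.
elim: j V => [|j IH] V fV dV; first by exists [::].
have [|x mx rx] := exists_regular noeth locm fV.
  by move=> u; apply: deep_nosoc dV.
have [||s [sj sm rs]] := IH (mquo x V).
- exact: fingen_surj (@mpi_surj R x V) fV.
- exact: deep_mquo.
exists (x :: s); split; [by rewrite /= sj | | exact/wreg_cons].
by move=> y; rewrite inE => /orP[/eqP ->|/sm].
Qed.

Lemma deep_qs j V s : wreg V s -> deep (size s + j) V -> deep j (qs V s).
Proof.
elim: s V => [|x s IH] V //= /wreg_cons[rx rs] dV.
by apply: IH => //; apply: deep_mquo.
Qed.

Lemma deep_pair j X Y : deep j X -> deep j Y -> deep j (X * Y)%type.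
Proof. by move=> dX dY i ij; apply: exv_pair; [apply: dX | apply: dY]. Qed.

Lemma deep_sub j X Y Z (i : {linear X -> Y}) (p : {linear Y -> Z}) :
  ses i p -> deep j.-1 Z -> deep j Y -> deep j X.
Proof.
move=> ip dZ dY n nj; apply: (exv_sub ip); last exact: dY.
move=> n0; apply: dZ.
by case: n nj n0 => // n; case: (j).
Qed.

Lemma deep_fpow j n X : deep j X -> deep j (fpow n X).
Proof. by move=> dX i /dX; apply: exv_sum; apply: fpow_sum. Qed.

(* Ext^i(k, W) is at most one-dimensional. *)
Definition thin i W := forall f1 f2 : {linear res k i -> W},
  (forall z, f1 (res_diff k i.+1 z) = 0) -> (forall z, f2 (res_diff k i.+1 z) = 0) ->
  exists a b : R, (~ m a \/ ~ m b) /\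
  exists g : {linear res k i.-1 -> W}, forall z, a *: f1 z + b *: f2 z = g (res_diff k i z).

(** The connecting map Ext^i(k, W/xW) → Ext^{i+1}(k, W) is injective because Ext^i(k, W) = 0. A
    relation between the images [g1], [g2] is therefore one between the classes of [f1], [f2]. *)
Lemma thin_mquo i x W : sreg x W -> exv i k W -> thin i.+1 W -> thin i (mquo x W).
Proof.
move=> rx eW tW f1 f2 f1d f2d.
have lift (f : {linear res k i -> mquo x W}) : (forall z, f (res_diff k i.+1 z) = 0) ->
  exists (f' : {linear res k i -> W}) (g : {linear res k i.+1 -> W}),
    [/\ forall z, mpi x W (f' z) = f z, forall z, x *: g z = f' (res_diff k i.+1 z) &
      forall z, g (res_diff k i.+2 z) = 0].
  move=> fd; have [f' f'E] := res_projective f (@mpi_surj R x W).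
  have [||g gE] := @linear_corestr R _ W W (mulby x W) (f' \o res_diff k i.+1).
  - exact: linear_inj.
  - by move=> z; apply/mpi_eq0; rewrite [LHS]f'E fd.
  exists f', g; split=> // z; apply: rx.
  by rewrite -mulbyE gE -[RHS](linear0 f'); congr (f' _); exact: (@diff_diff R k i.+1 z).
have [f1' [g1 [f1E g1E g1d]]] := lift _ f1d.
have [f2' [g2 [f2E g2E g2d]]] := lift _ f2d.
have [a [b [ab [h hE]]]] := tW _ _ g1d g2d.
have [|l lE] := eW (((a \*: f1') \+ (b \*: f2')) \- (x \*: h)).
  move=> z; rewrite [LHS]/= -!/(res_diff k i.+1 z) -g1E -g2E -hE scalerDr !scalerA.
  by rewrite ![x * _]mulrC subrr.
exists a, b; split=> //; exists (mpi x W \o l) => z.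
rewrite -[RHS]/(mpi x W (l (res_diff k i z))) -lE.
rewrite -[RHS]/(mpi x W (a *: f1' z + b *: f2' z - x *: h z)).
by rewrite linearB mpi_scale subr0 linearD 2!linearZ f1E f2E.
Qed.

Lemma thin_qs i s W : wreg W s -> deep (size s + i) W -> thin (size s + i) W -> thin i (qs W s).
Proof.
elim: s W => [|x s IH] W //= /wreg_cons[rx rs] dW tW.
apply: IH => //; first exact: deep_mquo.
by apply: thin_mquo => //; apply: dW.
Qed.

Lemma thin_soc W (u v : W) : thin 0 W -> soc m u -> soc m v ->
  exists a b : R, (~ m a \/ ~ m b) /\ a *: u + b *: v = 0.
Proof.
move=> tW su sv.
have [u0|u0] := pselect (u = 0).
  exists 1, 0; split; first by left; apply: max_proper locm.
  by rewrite u0 scaler0 scale0r addr0.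
have [v0|v0] := pselect (v = 0).
  exists 0, 1; split; first by right; apply: max_proper locm.
  by rewrite v0 scaler0 scale0r addr0.
have [f _ fu] := soc_map noeth locm su u0.
have [g _ gv] := soc_map noeth locm sv v0.
have [||a [b [ab [h hE]]]] := tW (f \o cover k) (g \o cover k).
- by move=> z; rewrite -[RHS](linear0 f); congr (f _); exact: (@cover_diff R k 0 z).
- by move=> z; rewrite -[RHS](linear0 g); congr (g _); exact: (@cover_diff R k 0 z).
exists a, b; split=> //; have := hE (free_gen R (kone m)).
rewrite /= linear0 => <-.
by rewrite [free_lift_fun _ _](@free_liftE R k k id) fu gv.
Qed.
End Depth.

(** * Krull dimension and modules of finite length *)

Section Dimension.
Local Open Scope ring_scope.
Local Open Scope classical_set_scope.
Variables (R : comNzRingType) (m : set R) (d : nat).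
Implicit Types V W : lmodType R.
Hypotheses (noeth : noetherian R) (locm : local_ring m) (dimR : krull_dim R d).

Lemma max_prime : prime_ideal m.
Proof.
split; [exact: max_ideal | exact: max_proper |] => x y mxy.
have [?|nx] := pselect (m x); [by left | right].
have [z xz] := local_unit noeth locm nx.
by rewrite -[y]mul1r -xz -mulrA mulrCA; apply: maxM.
Qed.

Lemma seq_mul_ideal s (I : set R) : ideal I -> (forall x, x \in s -> I x) ->
  forall a, @seq_mul R R^o s a -> I a.
Proof.
move=> sI Is a; suff: @seq_mul R R^o s `<=` I by apply.
apply: span_sub => // _ [x xs [u ->]].
by rewrite [_ *: _]mulrC; apply: (submodZ u sI); apply: Is.
Qed.

(** The prime [q] is maximal among the ideals over [s] that avoid all products x^n t with [t]
    outside [p]. The ideal (s) avoids them because [x] is regular modulo [s], and [q] is smaller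
    than [p] because it misses [x]. *)
Lemma prime_below (p : set R) s x : prime_ideal p -> (forall y, y \in rcons s x -> p y) ->
  wreg R^o (rcons s x) ->
  exists q, [/\ prime_ideal q, q `<` p & forall y, y \in s -> q y].
Proof.
move=> [sp p1 pp] ps rs.
have rx u : @seq_mul R R^o s (x * u) -> @seq_mul R R^o s u.
  have := rs (size s); rewrite size_rcons ltnS => /(_ (leqnn _) u).
  by rewrite -cats1 take_size_cat // nth_cat ltnn subnn.
have rxn n u : @seq_mul R R^o s (x ^+ n * u) -> @seq_mul R R^o s u.
  elim: n u => [|n IH] u; first by rewrite mul1r.
  by rewrite exprSr -mulrA => /IH /rx.
have ps' y : y \in s -> p y by move=> ys; apply: ps; rewrite mem_rcons inE ys orbT.
pose P (J : set R^o) := forall n (t : R), ~ p t -> ~ J (x ^+ n * t).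
have [|q [sq Pq sq' maxq]] := @noeth_max R noeth R^o P (@seq_mul R R^o s) (fingen_regular R) (@span_submodule _ _ _).
  by move=> n t npt /rxn /(seq_mul_ideal sp ps').
have qp u : q u -> p u.
  by move=> qu; apply: contrapT => npu; apply: (Pq 0%N u npu); rewrite expr0 mul1r.
have qx : ~ q x by move=> qx; apply: (Pq 1%N 1 p1); rewrite expr1 mulr1.
have px : p x by apply: ps; rewrite mem_rcons inE eqxx.
(* By maximality the ideal q + Ra meets the multiplicative set of these products. *)
have hit a : ~ q a -> exists n t r, ~ p t /\ q (x ^+ n * t - r * a).
  move=> nqa; apply: contrapT => nh; apply: nqa.
  pose T : set R^o := [set u | exists r : R, q (u - r * a)].
  have sT : submodule T.
    split; first by exists 0; rewrite mul0r subr0; case: sq.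
    move=> c u v [r ur] [r' vr']; exists (c * r + r').
    rewrite mulrDl -mulrA opprD addrACA -[c *: u]/(c * u) -mulrBr.
    exact: sq.2.
  have qT : q `<=` T by move=> u qu; exists 0; rewrite mul0r subr0.
  have PT : P T by move=> n t npt [r qr]; apply: nh; exists n, t, r.
  by rewrite -(maxq T sT PT qT); exists 1; rewrite mul1r subrr; case: sq.
exists q; split; last by move=> y ys; apply: sq'; apply: sub_span; exists y => //; exists 1; rewrite [_ *: _]mulr1.
  split=> // [|a b qab]; first by move=> /qp.
  apply: contrapT => /not_orP[/hit[n [t [r [npt qa]]]] /hit[n' [t' [r' [npt' qb]]]]].
  apply: (Pq (n + n')%N (t * t')); first by move=> /pp[].
  have -> : x ^+ (n + n') * (t * t') =
      (x ^+ n' * t') * (x ^+ n * t - r * a) + (r * a) * (x ^+ n' * t' - r' * b) + (r * r') * (a * b).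
    rewrite exprD; ring.
  by apply: (submodD sq); [apply: (submodD sq) |]; apply: (submodZ _ sq).
by split=> // /(_ _ px).
Qed.

Lemma chain_to (s : seq R) (p : set R) : prime_ideal p -> (forall y, y \in s -> p y) ->
  wreg R^o s -> exists2 c, prime_chain (size s) c & c (size s) = p.
Proof.
elim/last_ind: s p => [|s x IH] p pp ps rs; first by exists (fun=> p) => //; split.
have [q [pq qp sq]] := prime_below pp ps rs.
have [|c [cp cl] cq] := IH q pq sq.
  by have := @wreg_take R R^o _ (size s) rs; rewrite -cats1 take_size_cat.
rewrite size_rcons; exists (fun i => if (i <= size s)%N then c i else p); last by rewrite ltnn.
split=> i i_le; first by case: ifP => // /cp.
rewrite ltnS in i_le; rewrite i_le; case: ltnP => [i_lt|le_i]; first exact: cl.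
have -> : i = size s by apply/anti_leq; rewrite i_le.
by rewrite cq.
Qed.

Variable s : seq R.
Hypotheses (rs : wreg R^o s) (sd : size s = d).

(** Otherwise m would prolong the chain of length [d] that [chain_to] builds up to [p]. *)
Lemma prime_over_seq p : prime_ideal p -> (forall y, y \in s -> p y) -> p = m.
Proof.
move=> pp ps; apply: contrapT => pm.
have pm' : p `<` m.
  have [sp p1 _] := pp; have pm' := ideal_sub_max noeth locm sp p1.
  by split=> // mp; apply: pm; apply/seteqP.
have [c [cp cl] cd] := chain_to pp ps rs; rewrite sd in cp cl cd.
have := dimR.2 d.+1 (fun i => if (i <= d)%N then c i else m).
rewrite ltnn; move/(_ _)/notF; apply.
split=> i i_le; first by case: ifP => [/cp//|_]; apply: max_prime.
rewrite ltnS in i_le; rewrite i_le; case: ltnP => [i_lt|le_i]; first exact: cl.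
have -> : i = d by apply/anti_leq; rewrite i_le.
by rewrite cd.
Qed.

(** A maximal annihilator is a prime containing [s], hence equal to m. *)
Lemma socle_exists V (v : V) : kills V s -> v <> 0 -> exists2 u : V, soc m u & u <> 0.
Proof.
move=> ks /(max_ann_exists noeth)[u mu _]; exists u; last by case: mu.
suff <- : [set a | a *: u = 0] = m by move=> a.
have u0 := mu.1; apply: prime_over_seq => [|y ys]; last exact: ks.
split.
- split=> [|a b c /= bu cu]; rewrite /= ?scale0r //.
  by rewrite scalerDl -scalerA bu cu scaler0 addr0.
- by rewrite /= scale1r.
- move=> x y /= xyu; apply: contrapT => /not_orP[xu yu].
  exact: (max_ann_prime mu xu yu).
Qed.

(** Noetherian induction on the kernel of a surjection from [A] takes the place of induction on the
    length; a nonzero quotient contains a copy of k by [socle_exists]. *)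
Lemma devissage (P : lmodType R -> Prop) A : fingen A -> kills A s ->
  (forall T, trivial_module T -> P T) ->
  (forall (B Q : lmodType R) (i : {linear residue_field m -> B}) (p : {linear B -> Q}),
    ses i p -> fingen B -> kills B s -> P Q -> P B) -> P A.
Proof.
move=> fA kA P0 PS.
suff H (S : set A) : submodule S -> forall (Q : lmodType R) (p : {linear A -> Q}), surj p ->
    (forall a, p a = 0 <-> S a) -> P Q.
  apply: (H [set 0] _ A idfun) => //; last by move=> a; exists a.
  by split=> // a u v -> ->; rewrite scaler0 addr0.
move: S; apply: (noeth_ind noeth fA) => S sS IH Q p pS pK.
have [|/existsNP[v v0]] := pselect (trivial_module Q); first exact: P0.
have kQ := kills_surj pS kA; have [u su u0] := socle_exists kQ v0.
have [f fI fu] := soc_map noeth locm su u0.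
have [Q' [q fs]] : exists (Q' : lmodType R) (q : {linear Q -> Q'}), ses f q.
  by do 2!eexists; apply: ses_quo fI.
apply: (PS _ _ _ _ fs) => //; first exact: fingen_surj pS fA.
have [_ qS qK] := fs.
apply: (IH [set a | q (p a) = 0] _ _ _ (q \o p)) => //.
- split; first by rewrite /= !linear0.
  move=> a x y qx qy; rewrite /mkset /= in qx qy *.
  by rewrite !linearP qx qy scaler0 addr0.
- split=> [a /pK /= ->|]; first by rewrite linear0.
  have [a au] := pS u => /(_ a) h; apply: u0; rewrite -au; apply/pK/h => /=.
  by apply/qK; exists (kone m); rewrite fu.
- by move=> z; have [y <-] := qS z; have [x <-] := pS y; exists x.
Qed.

End Dimension.

(** * Ext into the canonical module *)

Section InjectiveResolution.
Local Open Scope ring_scope.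
Local Open Scope classical_set_scope.
Variables (R : comNzRingType) (w : lmodType R).
Implicit Types A B C K P U V W X Y Z N : lmodType R.
Variables (E : nat -> lmodType R) (e : {linear w -> E 0%N})
  (d : forall n, {linear E n -> E n.+1}).
Hypotheses (Einj : forall n, injective_module (E n)) (eI : injective e)
  (d0 : forall x, d 0%N x = 0 <-> exists y, x = e y)
  (dS : forall n x, d n.+1 x = 0 <-> exists y, x = d n y).

(* [van n A] says that Ext^n(A, w) = 0, computed on the resolution E of w. *)
Definition van (n : nat) (A : lmodType R) : Prop := match n with
  | 0 => forall f : {linear A -> E 0%N}, (forall a, d 0%N (f a) = 0) -> forall a, f a = 0
  | n'.+1 => forall f : {linear A -> E n'.+1}, (forall a, d n'.+1 (f a) = 0) ->
      exists g : {linear A -> E n'}, forall a, f a = d n' (g a) end.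

Lemma dd n x : d n.+1 (d n x) = 0.
Proof. by apply/dS; exists x. Qed.

(** With [van_sub] and [van_quo], the exactness of the long sequence of Ext(-, w) at its three kinds
    of terms. Maps on [A] extend to [B] by injectivity of the terms of [E]. *)
Lemma van_mid A B C (i : {linear A -> B}) (p : {linear B -> C}) n :
  ses i p -> van n.+1 A -> van n.+1 C -> van n.+1 B.
Proof.
move=> ip vA vC f fd; have [iI pS pK] := ip.
have [g gE] := vA (f \o i) (fun a => fd _).
have [g' g'E] := Einj g iI.
have [|h hE] := @linear_factor R _ _ _ p (f \- (d n \o g')) pS.
  by move=> b /pK[a ->]; rewrite /= g'E; have /= -> := gE a; rewrite subrr.
have [|l lE] := vC h.
  by move=> c; have [b <-] := pS c; rewrite hE linearB fd sub0r; apply/eqP; rewrite oppr_eq0; apply/eqP/dd.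
exists (g' \+ (l \o p)) => b; rewrite linearD /= -lE hE /=; zmod.
Qed.

Lemma van_sub A B C (i : {linear A -> B}) (p : {linear B -> C}) n :
  ses i p -> van n.+1 B -> van n.+2 C -> van n.+1 A.
Proof.
move=> ip vB vC f fd; have [iI pS pK] := ip.
have [g gE] := Einj f iI.
have [|h hE] := @linear_factor R _ _ _ p (d n.+1 \o g) pS.
  by move=> b /pK[a ->]; rewrite /= gE.
have [|l lE] := vC h; first by move=> c; have [b <-] := pS c; rewrite hE; apply: dd.
have [|t tE] := vB (g \- (l \o p)).
  by move=> b; rewrite linearB /= -lE hE subrr.
exists (t \o i) => a; have /= <- := tE (i a).
by rewrite gE (ses0 _ ip) linear0 subr0.
Qed.

Lemma van_quo A B C (i : {linear A -> B}) (p : {linear B -> C}) n :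
  ses i p -> van n.+1 A -> van n.+2 B -> van n.+2 C.
Proof.
move=> ip vA vB h hd; have [iI pS pK] := ip.
have [g gE] := vB (h \o p) (fun b => hd _).
have [|t tE] := vA (g \o i).
  by move=> a; have /= <- := gE (i a); rewrite (ses0 _ ip) linear0.
have [t' t'E] := Einj t iI.
have [|l lE] := @linear_factor R _ _ _ p (g \- (d n \o t')) pS.
  by move=> b /pK[a ->]; rewrite /= t'E; have /= -> := tE a; rewrite subrr.
exists l => c; have [b <-] := pS c; rewrite lE linearB dd subr0.
exact: gE.
Qed.

Lemma van_restr A B C (i : {linear A -> B}) (p : {linear B -> C}) (f : {linear A -> w}) :
  ses i p -> van 1 C -> exists g : {linear B -> w}, forall a, g (i a) = f a.
Proof.
move=> ip vC; have [iI pS pK] := ip.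
have [g gE] := Einj (e \o f) iI.
have [|h hE] := @linear_factor R _ _ _ p (d 0%N \o g) pS.
  by move=> b /pK[a ->]; rewrite /= gE; apply/d0; exists (f a).
have [|l lE] := vC h; first by move=> c; have [b <-] := pS c; rewrite hE; apply: dd.
have [|t tE] := @linear_corestr R _ _ _ e (g \- (l \o p)) eI.
  by move=> b; apply/d0; rewrite linearB /= -lE hE subrr.
by exists t => a; apply: eI; rewrite tE /= gE (ses0 _ ip) linear0 subr0.
Qed.

Lemma van_of_restr A B C (i : {linear A -> B}) (p : {linear B -> C}) :
  ses i p -> van 1 B ->
  (forall f : {linear A -> w}, exists g : {linear B -> w}, forall a, g (i a) = f a) ->
  van 1 C.
Proof.
move=> ip vB ext h hd; have [iI pS pK] := ip.
have [g gE] := vB (h \o p) (fun b => hd _).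
have [|t tE] := @linear_corestr R _ _ _ e (g \o i) eI.
  by move=> a; apply/d0; have /= <- := gE (i a); rewrite (ses0 _ ip) linear0.
have [t' t'E] := ext t.
have [|l lE] := @linear_factor R _ _ _ p (g \- (e \o t')) pS.
  by move=> b /pK[a ->]; rewrite /= t'E tE /= subrr.
exists l => c; have [b <-] := pS c; rewrite lE linearB.
rewrite [X in _ - X](_ : _ = 0) ?subr0; last by apply/d0; exists (t' b).
exact: gE.
Qed.

Lemma van_proj n P : projective P -> van n.+1 P.
Proof.
move=> pP f fd.
have [g gE] := @linear_corestr R _ _ _ (ker_incl (d n.+1)) f (@ker_incl_inj _ _ _ _) (fun a => ex_ker (fd a)).
have [q qE] := @linear_corestr R _ _ _ (ker_incl (d n.+1)) (d n) (@ker_incl_inj _ _ _ _) (fun a => ex_ker (dd a)).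
have [|h hE] := pP _ _ q g.
  move=> z; have [y zy] := (dS _).1 (kerP z); exists y.
  by apply: (@ker_incl_inj _ _ _ (d n.+1)); rewrite qE.
by exists h => a; rewrite -gE -hE qE.
Qed.

Lemma van_trivial n A : trivial_module A -> van n A.
Proof.
by case: n => [|n] tA f fd; [move=> a | exists \0 => a]; have -> : a = 0 by [exact: tA]; rewrite !linear0.
Qed.

Lemma van_trivialE n A : trivial_module (E n.+1) -> van n.+1 A.
Proof. by move=> tE f fd; exists \0 => a; rewrite linear0; apply: tE. Qed.

(* Ext computed on a resolution T of X by acyclic modules. *)
Lemma van_chase i X (T : nat -> lmodType R) (dl : forall n, {linear T n.+1 -> T n})
    (ep : {linear T 0%N -> X}) :
  surj ep -> (forall t, ep t = 0 <-> exists u, t = dl 0%N u) ->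
  (forall n t, dl n (dl n.+1 t) = 0) ->
  (forall n, (n < i.+1)%N -> forall t, dl n t = 0 -> exists u, t = dl n.+1 u) ->
  (forall n j, van j.+1 (T n)) ->
  van i.+1 X <-> forall f : {linear T i.+1 -> w}, (forall t, f (dl i.+1 t) = 0) ->
    exists g : {linear T i -> w}, forall t, f t = g (dl i t).
Proof.
elim: i X T dl ep => [|i IH] X T dl ep epS epK dd' ex vT.
all: have epd u : ep (dl 0%N u) = 0 by apply/epK; exists u.
all: have [s sE] := @linear_corestr R _ _ _ (ker_incl ep) (dl 0%N) (@ker_incl_inj _ _ _ _) (fun u => ex_ker (epd u)).
all: have sS : surj s by (move=> z; have [u zu] := (epK _).1 (kerP z); exists u;
  apply: (@ker_incl_inj _ _ _ ep); rewrite sE).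
all: have ks := ses_ker epS.
  split=> [vX f fd|ext].
    have [|f' f'E] := @linear_factor R _ _ _ s f sS.
      move=> u su; have [|v ->] := ex 0%N isT u; last exact: fd.
      by rewrite -sE su linear0.
    have [g gE] := van_restr f' ks vX.
    by exists g => t; rewrite -sE gE f'E.
  apply: (van_of_restr ks) => // f.
  have [|g gE] := ext (f \o s).
    move=> t; rewrite /= [s _](_ : _ = 0) ?linear0 //.
    by apply: (@ker_incl_inj _ _ _ ep); rewrite sE dd' linear0.
  by exists g => z; have [u <-] := sS z; rewrite sE -gE.
have <- : van i.+1 (ker ep) <-> _ := IH _ (fun n => T n.+1) (fun n => dl n.+1) s sS _ _ _ _.
- split=> v; [exact: (van_sub ks) | exact: (van_quo ks v)].
- move=> t; split=> [st|[u ->]].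
    by apply: (ex 0%N) => //; rewrite -sE st linear0.
  by apply: (@ker_incl_inj _ _ _ ep); rewrite sE dd' linear0.
- by move=> n t; apply: dd'.
- by move=> n n_lt t; apply: ex.
- by move=> n j; apply: vT.
Qed.

Variable m : set R.
Hypotheses (noeth : noetherian R) (locm : local_ring m) (fw : fingen w).

Lemma fingen_hom A W : fingen A -> fingen W -> fingen (hom_module A W).
Proof.
move=> /fingenP[n [p pS]] fW.
have [|f fE] := @ex_linear R (hom_module A W) (fpow n W) (fun h => [ffun i => (h : {linear A -> W}) (p (fgen R i))]).
  by move=> a h h'; apply/ffunP => i; rewrite !ffunE.
apply: (fingen_inj noeth (i := f)); last exact: fingen_fpow.
apply: linear_inj => h; rewrite fE => /ffunP h0; apply: hom_ext => a.
have [v <-] := pS a; apply: (@fpow_ext R n W ((h : {linear A -> W}) \o p) \0) => i.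
by have := h0 i; rewrite !ffunE.
Qed.

(** The premise says that Ext^{i+1}(N, w) equals x times itself. Computed on [E] it is not visibly
    finitely generated, so dimension shifting leads down to Ext^1, a quotient of Hom(ker p, w),
    where Nakayama applies. *)
Lemma van_nakayama i N x : fingen N -> m x ->
  (forall f : {linear N -> E i.+1}, (forall a, d i.+1 (f a) = 0) ->
    exists (g : {linear N -> E i.+1}) (h : {linear N -> E i}),
      (forall a, d i.+1 (g a) = 0) /\ forall a, f a = x *: g a + d i (h a)) ->
  van i.+1 N.
Proof.
elim: i N => [|i IH] N fN mx div.
all: have [n [p pS]] := (fingenP N).1 fN.
all: have ks := ses_ker pS.
all: have [_ _ pK] := ks.
all: have fK : fingen (ker p) by apply: (fingen_inj noeth (@ker_incl_inj _ _ _ p)); apply: fingen_fpow; apply: fingen_regular.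
all: have vP j : van j.+1 (fpow n R^o) by apply: van_proj; apply: fpow_projective.
  apply: (van_of_restr ks) => // f.
  (* Ext^1(N, w) is the quotient of Hom(ker p, w) by [B]. *)
  pose B : set (hom_module (ker p) w) := [set h | exists g : {linear fpow n R^o -> w},
    forall a, g (ker_incl p a) = (h : {linear ker p -> w}) a].
  apply: (@nakayama_fingen R m noeth locm _ x B (fingen_hom fK fw) mx).
    split; first by exists \0.
    move=> a h h' [g gE] [g' g'E]; exists ((a \*: g) \+ g') => z.
    by rewrite [LHS]/= gE g'E.
  (* Here [t] represents the class of [h] in Ext^1(N, w). Dividing it by [x] and pulling back along
     [p] yields [h1] with h - x h1 in [B]. *)
  move=> h; have [g gE] := Einj (e \o (h : {linear ker p -> w})) (@ker_incl_inj _ _ _ p).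
  have [|t tE] := @linear_factor R _ _ _ p (d 0%N \o g) pS.
    by move=> b /pK[a ->]; rewrite /= gE; apply/d0; exists ((h : {linear ker p -> w}) a).
  have [|t1 [q [t1d tq]]] := div t; first by move=> c; have [b <-] := pS c; rewrite tE; apply: dd.
  have [g1 g1E] := vP 0%N (t1 \o p) (fun b => t1d _).
  have [|h1 h1E] := @linear_corestr R _ _ _ e (g1 \o ker_incl p) eI.
    by move=> a; apply/d0; have /= <- := g1E (ker_incl p a); rewrite [p _]kerP linear0.
  have [|l lE] := @linear_corestr R _ _ _ e (g \- ((x \*: g1) \+ (q \o p))) eI.
    move=> b; apply/d0; rewrite linearB linearD linearZ -[d 0%N (g b)]/((d 0%N \o g) b) -tE tq.
    by rewrite /=; have /= -> := g1E b; rewrite subrr.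
  exists (h1 : hom_module _ _), l => a; apply: eI; rewrite lE.
  rewrite -[RHS]/(e ((h : {linear ker p -> w}) a - x *: h1 a)) linearB linearZ h1E.
  by rewrite -[LHS]/(g (ker_incl p a) - (x *: g1 (ker_incl p a) + q (p (ker_incl p a)))) kerP linear0 addr0 gE.
apply: (van_quo ks) => //; apply: IH => // f fd.
(* Divisibility passes from [N] to ker p: [t] is the image of [f] under the connecting map. *)
have [g gE] := Einj f (@ker_incl_inj _ _ _ p).
have [|t tE] := @linear_factor R _ _ _ p (d i.+1 \o g) pS.
  by move=> b /pK[a ->]; rewrite /= gE.
have [|t1 [q [t1d tq]]] := div t; first by move=> c; have [b <-] := pS c; rewrite tE; apply: dd.
have [g1 g1E] := vP i.+1 (t1 \o p) (fun b => t1d _).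
have [|l lE] := vP i (g \- ((x \*: g1) \+ (q \o p))).
  move=> b; rewrite linearB linearD linearZ -[d i.+1 (g b)]/((d i.+1 \o g) b) -tE tq.
  by rewrite /=; have /= -> := g1E b; rewrite subrr.
exists (g1 \o ker_incl p), (l \o ker_incl p); split=> a.
  by have /= <- := g1E (ker_incl p a); rewrite [p _]kerP linear0.
rewrite -gE /=; have /= <- := lE (ker_incl p a).
by rewrite [p _]kerP linear0 addr0; zmod.
Qed.

(** The obstruction to dividing a class of Ext^{n+1}(N, w) by [x] lies in Ext^{n+2}(N/xN, w). *)
Lemma van_mul n N x : fingen N -> m x -> sreg x N -> van n.+2 (mquo x N) -> van n.+1 N.
Proof.
move=> fN mx rx vN; apply: (van_nakayama fN mx) => f fd.
have [iI pS pK] := ses_mul rx.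
have [g gE] := Einj f iI.
have [|h hE] := @linear_factor R _ _ _ _ (d n.+1 \o g) pS.
  by move=> b /pK[a ->]; rewrite /= gE.
have [|l lE] := vN h; first by move=> c; have [b <-] := pS c; rewrite hE; apply: dd.
exists (g \- (l \o mpi x N)), \0; split=> a.
  by rewrite linearB -lE hE subrr.
rewrite -gE mulbyE [d n _]linear0 addr0 -[RHS]/(x *: (g a - l (mpi x N a))) scalerBr.
by rewrite -[x *: l _]linearZ mquo_kill linear0 subr0 linearZ.
Qed.

(** Each regular element raises the bound by one. For projective [A] and n = 0 this plays the part
    of the projective dimension of A/(s)A. *)
Lemma van_qs s A n : wreg A s -> (forall i, (n <= i)%N -> van i.+1 A) ->
  forall i, (n + size s <= i)%N -> van i.+1 (qs A s).
Proof.
elim: s A n => [|x s IH] A n /=; first by rewrite addn0.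
move=> /wreg_cons[rx rs] vA i; rewrite addnS -addSn; apply: IH => // {}i.
by case: i => // i ni; apply: (van_quo (ses_mul rx)); apply: vA => //; apply: leqW.
Qed.

Section Cohen.
Variables (D : nat) (s : seq R) (r : nat).
Hypotheses (dimR : krull_dim R D) (ms : forall x, x \in s -> m x) (rs : wreg R^o s)
  (sD : size s = D) (Er : forall n, (r < n)%N -> trivial_module (E n)).

(** Nakayama through a surjection of [V] onto k: the elements of [t] kill k, so V = (t)V would make
    the generator of k zero. *)
Lemma qs_regular_neq0 V t : (forall x, x \in t -> m x) -> fingen V -> ~ trivial_module V ->
  ~ trivial_module (qs V t).
Proof.
move=> mt fV /(map_to_residue noeth locm fV)[f fS] tq.
have [v fv] := fS (kone m).
suff : kone m = 0 by rewrite -[kone m]scale1r (residue_eq0 locm) => /(max_proper locm).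
rewrite -fv; apply: (@kills_seq_mul _ _ t).
  by move=> x xt u; apply: (soc_residue locm); apply: mt.
by apply: seq_mul_map; apply/qpi_eq0; apply: tq.
Qed.

Lemma regular_nontrivial : ~ trivial_module (R^o : lmodType R).
Proof. by move=> /(_ 1) /eqP; rewrite oner_eq0. Qed.

Lemma van_finite_length n A : (D <= n)%N -> fingen A -> kills A s -> van n.+1 A.
Proof.
(* The number [t] bounds the distance from degree n + 1 to the end of [E], where every Ext
   vanishes. *)
suff H t : forall n A, (D <= n)%N -> (r < n.+1 + t)%N -> fingen A -> kills A s -> van n.+1 A.
  by move=> Dn; apply: (H r.+1) => //; rewrite addnS ltnS leq_addl.
elim: t => [|t IH] {}n {}A Dn rn fA kA; first by apply: van_trivialE; apply: Er; rewrite addn0 in rn.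
have vk : van n.+1 (residue_field m).
  have kR := @kills_qs R R^o [::] s (fun x xs => ltac:(by [])).
  have /existsNP[v v0] := qs_regular_neq0 ms (fingen_regular R) regular_nontrivial.
  have [u su u0] := socle_exists noeth locm dimR rs sD kR v0.
  have [f fI fu] := soc_map noeth locm su u0.
  have fs := ses_quo fI; have [_ fS _] := fs.
  apply: (van_sub fs).
    apply: (@van_qs _ _ 0) => //; last by rewrite add0n sD.
    move=> i _; apply: van_proj => B C p g pS.
    have [b bE] := pS (g 1); have [|h hE] := @ex_linear R R^o B (fun a => a *: b).
      by move=> a c c' /=; rewrite scalerDl scalerA.
    by exists h => a; rewrite hE linearZ /= bE -linearZ /= [_ *: _]mulr1.
  apply: IH; [exact: leqW | by rewrite addSnnS | |].
    by apply: fingen_surj fS _; apply: fingen_surj (@qpi_surj R R^o s) (fingen_regular R).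
  exact: kills_surj fS kR.
apply: (devissage noeth locm dimR rs sD fA kA) => [T tT|B Q i p ip fB kB vQ].
  exact: van_trivial.
exact: van_mid ip vk vQ.
Qed.

(** Interpolates between finite length ([t] empty, n at least [D]) and maximal Cohen-Macaulay
    modules ([p] empty, any n): each element of [t] lowers the bound on n by one. *)
Lemma van_wreg t p N n : p ++ t = s -> kills N p -> wreg N t -> fingen N ->
  (D <= n + size t)%N -> van n.+1 N.
Proof.
elim: t p N n => [|x t IH] p N n ps kp rt fN.
  by rewrite addn0 => Dn; apply: van_finite_length => //; rewrite -ps cats0.
rewrite /= addnS -addSn => Dn; have /wreg_cons[rx rt'] := rt.
apply: (@van_mul _ _ x) => //; first by apply: ms; rewrite -ps mem_cat inE eqxx orbT.
apply: (IH (rcons p x)) => //; first by rewrite cat_rcons.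
- by rewrite -cats1; apply: (@kills_qs R N p [:: x]).
- exact: fingen_surj (@mpi_surj R x N) fN.
Qed.
End Cohen.

Lemma fingen_pair U V : fingen U -> fingen V -> fingen (U * V)%type.
Proof.
move=> [su suT] [sv svT].
have [|f fE] := @ex_linear R U (U * V)%type (fun u => (u, 0)).
  by move=> a u v; congr pair; rewrite /= scaler0 addr0.
have [|g gE] := @ex_linear R V (U * V)%type (fun v => (0, v)).
  by move=> a u v; congr pair; rewrite /= scaler0 addr0.
exists (map f su ++ map g sv); apply/seteqP; split=> // -[u v] _.
apply/span_cat; exists (f u).
  apply: (@span_image _ _ _ _ [set` su]) => [x xs|]; last by rewrite suT.
  by apply: span_mem; apply: map_f.
have -> : (u, v) - f u = g v by rewrite fE gE; congr pair; rewrite /= ?subrr ?subr0.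
apply: (@span_image _ _ _ _ [set` sv]) => [x xs|]; last by rewrite svT.
by apply: span_mem; apply: map_f.
Qed.

Lemma wreg_fst U V s : wreg (U * V)%type s -> wreg U s.
Proof.
have [|f fE] := @ex_linear R U (U * V)%type (fun u => (u, 0)).
  by move=> a u v; congr pair; rewrite /= scaler0 addr0.
by apply: (@wreg_retract _ _ _ f fst) => u; rewrite fE.
Qed.

Lemma wreg_snd U V s : wreg (U * V)%type s -> wreg V s.
Proof.
have [|f fE] := @ex_linear R V (U * V)%type (fun v => (0, v)).
  by move=> a u v; congr pair; rewrite /= scaler0 addr0.
by apply: (@wreg_retract _ _ _ f snd) => u; rewrite fE.
Qed.

Section CohenMacaulay.
Variables (D r : nat).
Hypotheses (dimR : krull_dim R D) (deepR : deep m D R^o)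
  (Er : forall n, (r < n)%N -> trivial_module (E n)).

Lemma van_deep X i : fingen X -> deep m D X -> van i.+1 X.
Proof.
move=> fX dX.
(* The sequence is to be regular on R as well, since the case of finite length embeds k in R/(s). *)
have [s [sD ms rs]] := deep_seq noeth locm (fingen_pair (fingen_regular R) fX) (deep_pair deepR dX).
apply: (@van_wreg D s r dimR ms (wreg_fst rs) sD Er s [::]) => //; first exact: wreg_snd rs.
by rewrite sD leq_addl.
Qed.

(** A syzygy gains one unit of depth and lowers the Ext degree by one. In the induction [j] bounds
    the defect of depth; for j = D nothing is required of [X]. *)
Lemma van_above X i : fingen X -> (D <= i)%N -> van i.+1 X.
Proof.
suff H j : forall X i, fingen X -> deep m (D - j) X -> (j <= i)%N -> van i.+1 X.
  by move=> fX; apply: (H D) => //; rewrite subnn.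
elim: j => [|j IH] {}X {}i fX dX ji; first by apply: van_deep => //; rewrite subn0 in dX.
have [n [p pS]] := (fingenP X).1 fX; have ks := ses_ker pS.
case: i ji => // i ji; apply: (van_quo ks); last by apply: van_proj; apply: fpow_projective.
apply: IH => //.
  by apply: (fingen_inj noeth (@ker_incl_inj _ _ _ p)); apply: fingen_fpow; apply: fingen_regular.
apply: (deep_sub ks); first by rewrite -subn1 -subnDA addn1.
by apply: deep_fpow; apply: deepW deepR; apply: leq_subr.
Qed.
End CohenMacaulay.
End InjectiveResolution.

(** * Endomorphisms of the canonical module *)

Section Endomorphisms.
Local Open Scope ring_scope.
Local Open Scope classical_set_scope.
Variables (R : comNzRingType) (w : lmodType R).
Implicit Types A B C K P U V W X Y Z N : lmodType R.
Variables (E : nat -> lmodType R) (e : {linear w -> E 0%N})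
  (d : forall n, {linear E n -> E n.+1}).
Hypotheses (Einj : forall n, injective_module (E n)) (eI : injective e)
  (d0 : forall x, d 0%N x = 0 <-> exists y, x = e y)
  (dS : forall n x, d n.+1 x = 0 <-> exists y, x = d n y).

(** A relative injectivity of [W] among modules killed by [p]. For empty [p], j = 0 and W = w it is
    [van_restr]; for p = s and j = D the condition on Ext holds for every finitely generated [C]. *)
Definition ext_prop (p : seq R) j W := forall A B C (i : {linear A -> B}) (q : {linear B -> C}),
  ses i q -> kills B p -> van d j.+1 C ->
  forall f : {linear A -> W}, exists g : {linear B -> W}, forall a, g (i a) = f a.

Lemma kills_pair U V p : kills U p -> kills V p -> kills (U * V)%type p.
Proof. by move=> kU kV x xp [u v]; congr pair; [apply: kU | apply: kV]. Qed.

(* Hom(A, W/xW) embeds in Ext^1(A, W) when x kills A; here a map to W/xW is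
   extended by splitting W -x-> W off a suitable extension K. *)
Lemma ext_prop_mquo p j x W : kills W p -> sreg x W ->
  (forall K : choiceType, van d j.+1 (qs (free_mod R K) p)) ->
  ext_prop p j W -> ext_prop (rcons p x) j.+1 (mquo x W).
Proof.
move=> kW rx vP eW A B C i q iq kB vC f; have [iI qS qK] := iq.
have kB' : kills B p by move=> y yp; apply: kB; rewrite mem_rcons inE yp orbT.
have xB (b : B) : x *: b = 0 by apply: kB; rewrite mem_rcons inE eqxx.
(* [P] is free over R/(p) and maps onto [B]. *)
have [be beE] := qs_lift (cover B) kB'; set P := qs _ p in be beE.
have beS : surj be by move=> b; have [u <-] := cover_surj b; exists (qpi _ p u); rewrite beE.
(* [K] consists of the triples (a, v, z) with f a = v modulo [x] and i a + be z = 0. It is the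
   pullback of W -x-> W → W/xW along the map from the kernel of q be to W/xW sending z to f(a),
   hence an extension of that kernel by [W]. *)
pose T : lmodType R := ((A * W) * P)%type.
have [la laE] : exists la : {linear T -> mquo x W}, forall t, la t = f t.1.1 - mpi x W t.1.2.
  by exists ((f \o (fst \o fst)) \- (mpi x W \o (snd \o fst))).
have [ro roE] : exists ro : {linear T -> B}, forall t, ro t = i t.1.1 + be t.2.
  by exists ((i \o (fst \o fst)) \+ (be \o snd)).
pose ro' : {linear ker la -> B} := ro \o ker_incl la.
pose K := ker ro'; pose inK : {linear K -> T} := ker_incl la \o ker_incl ro'.
have inKI : injective inK by move=> y z /ker_incl_inj /ker_incl_inj.
have exK t : la t = 0 -> ro t = 0 -> exists y, t = inK y.
  by move=> /ex_ker[y ->] /(@ex_ker _ _ _ ro')[z ->]; exists z.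
have laK y : la (inK y) = 0 by exact: kerP.
have roK y : ro (inK y) = 0 by exact: (kerP y).
have [jo joE] : exists jo : {linear W -> T}, forall v, jo v = ((0, x *: v), 0).
  apply: ex_linear => a u v; congr pair; last by rewrite /= scaler0 addr0.
  by congr pair; rewrite /= ?scaler0 ?addr0 // scalerDr !scalerA mulrC.
have [|j' j'E] := @linear_corestr R _ _ _ inK jo inKI.
  by move=> v; apply: exK; rewrite ?laE ?roE joE /= !linear0 ?mpi_scale ?subr0 ?addr0.
have qbS : surj (q \o be) by move=> c; have [b <-] := qS c; have [u <-] := beS b; exists u.
have qbs := ses_ker qbS.
have [|th thE] := @linear_corestr R _ _ _ (ker_incl (q \o be)) (snd \o inK) (@ker_incl_inj _ _ _ _).
  move=> y; apply: ex_ker; have := roK y; rewrite roE => /(congr1 q).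
  by rewrite linearD (ses0 _ iq) add0r linear0.
have sesK : ses j' th.
  split.
  - apply: linear_inj => v jv; apply: rx; have := j'E v; rewrite jv linear0 joE => h.
    by have /esym := congr1 (fun z : T => z.1.2) h.
  - move=> z; have [a ai] := (qK _).1 (kerP z).
    have [v vf] := @mpi_surj R x W (f (- a)).
    have [||y yE] := exK ((- a, v), ker_incl (q \o be) z).
    + by rewrite laE /= vf subrr.
    + by rewrite roE -[X in _ + X]/(be (ker_incl (q \o be) z)) ai /= linearN addNr.
    by exists y; apply: (@ker_incl_inj _ _ _ (q \o be)); rewrite thE -[LHS]/((inK y).2) -yE.
  - move=> y; split=> [ty|[v ->]]; last first.
      by apply: (@ker_incl_inj _ _ _ (q \o be)); rewrite thE linear0 -[LHS]/((inK (j' v)).2) j'E joE.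
    have y2 : (inK y).2 = 0 by rewrite -[LHS]/((snd \o inK) y) -thE ty linear0.
    have y1 : (inK y).1.1 = 0.
      by have := roK y; rewrite roE y2 linear0 addr0 -[in RHS](linear0 i) => /iI.
    have := laK y; rewrite laE y1 linear0 sub0r => /eqP; rewrite oppr_eq0 => /eqP/mpi_eq0[v yv].
    exists v; apply: inKI; rewrite j'E joE.
    by case: (inK y) y1 y2 yv => [[a u] z] /= -> -> ->.
have kK : kills K p.
  apply: kills_inj inKI _; apply: kills_pair; first apply: kills_pair => //.
    exact: kills_inj iI kB'.
  exact: (@kills_qs R (free_mod R B) [::] p (fun y yp => ltac:(by []))).
(* [F] splits [j']: the kernel of q be has no Ext^{j+1} into w, as [P] has none and [C] has no
   Ext^{j+2}. *)
have [|F FE] := eW _ _ _ j' th sesK kK _ idfun.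
  exact: (van_sub Einj dS qbs (vP _) vC).
(* Multiplication by [x] maps the kernel of [la] into [K], because [x] kills [B] and W/xW. The
   extension of [f] sends ro t to F(xt) modulo [x]; on [K] this is xF(t), so the value is well
   defined. *)
have [|G0 G0E] := @linear_corestr R _ _ _ inK (mulby x _ \o ker_incl la) inKI.
  move=> t; apply: exK; first by rewrite -[LHS]/(la (x *: ker_incl la t)) linearZ kerP; exact: scaler0.
  by rewrite -[LHS]/(ro (x *: ker_incl la t)) linearZ; exact: xB.
have [||g gE] := @linear_factor R _ _ _ ro' (mpi x W \o F \o G0).
- move=> b; have [u ub] := beS b.
  have [|t tE] := @ex_ker _ _ _ la ((0, 0), u); first by rewrite laE -[LHS]/(f 0 - mpi x W 0) !linear0 ?subr0 ?addr0.
  by exists t; rewrite -[LHS]/(ro (ker_incl la t)) -tE roE -[LHS]/(i 0 + be u) linear0 add0r.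
- move=> t rt; have [y ty] := exK _ (kerP t) rt.
  have yE : G0 t = x *: y by apply: inKI; rewrite G0E linearZ -ty.
  by rewrite -[LHS]/(mpi x W (F (G0 t))) yE linearZ mpi_scale.
(* The lift (a, v, 0) of i a becomes (0, xv, 0) = j' v after multiplication by [x], so [F] returns
   [v], a representative of f a. *)
exists g => a; have [v vf] := @mpi_surj R x W (f a).
have [|t tE] := @ex_ker _ _ _ la ((a, v), 0); first by rewrite laE /= vf subrr.
have -> : i a = ro' t by rewrite -[RHS]/(ro (ker_incl la t)) -tE roE -[RHS]/(i a + be 0) linear0 addr0.
have xa : x *: a = 0 by apply: iI; rewrite linear0 linearZ; exact: xB.
rewrite gE -[LHS]/(mpi x W (F (G0 t))).
have -> : G0 t = j' v.
  apply: inKI; rewrite G0E j'E joE -[LHS]/(x *: ker_incl la t) -tE; congr pair; last exact: scaler0.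
  by congr pair.
by rewrite FE.
Qed.

Lemma ext_prop_qs t p W : ext_prop p (size p) W -> kills W p -> wreg W t ->
  wreg R^o (p ++ t) -> ext_prop (p ++ t) (size (p ++ t)) (qs W t).
Proof.
elim: t p W => [|x t IH] p W; first by rewrite cats0.
move=> eW kW /wreg_cons[rx rt] rp; rewrite -cat_rcons in rp *; apply: IH => //=.
  rewrite size_rcons; apply: ext_prop_mquo => // K.
  apply: (van_qs Einj dS (n := 0)) => // [|i _]; last by apply: van_proj => //; apply: free_projective.
  by apply: wreg_free; have [] := wreg_cat rp; rewrite cat_rcons in rp; have [] := wreg_cat rp.
by rewrite -cats1; apply: (@kills_qs R W p [:: x]).
Qed.

Variable m : set R.
Hypotheses (noeth : noetherian R) (locm : local_ring m) (fw : fingen w).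
Variables (D r : nat) (s : seq R).
Hypotheses (dimR : krull_dim R D) (ms : forall x, x \in s -> m x) (rs : wreg R^o s)
  (sD : size s = D) (Er : forall n, (r < n)%N -> trivial_module (E n)).
Hypotheses (rw : wreg w s) (tw : thin m D w) (w0 : ~ trivial_module w).

Let Wb := qs w s.

Lemma thin_quotient : thin m 0 Wb.
Proof.
have sw : deep m (size s + 0) w by rewrite addn0; apply: deep_wreg.
by apply: thin_qs => //; rewrite addn0 sD.
Qed.

Lemma kills_quotient V : kills (qs V s) s.
Proof. exact: (@kills_qs R V [::] s (fun y yp => ltac:(by []))). Qed.

(** By [thin_quotient] any socle element [v] is dependent on [u], and the coefficient of [v] is a
    unit, since otherwise a unit would kill [u]. *)
Lemma socle_generator : exists u : Wb, [/\ soc m u, u <> 0 &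
  forall v : Wb, soc m v -> exists c : R, v = c *: u].
Proof.
have /existsNP[v v0] : ~ trivial_module Wb by apply: (qs_regular_neq0 noeth locm).
have [u su u0] := socle_exists noeth locm dimR rs sD (@kills_quotient w) v0.
exists u; split=> // {v v0} v sv.
have [a [b [ab abuv]]] := thin_soc noeth locm thin_quotient su sv.
have nb : ~ m b.
  move=> mb; case: ab => // /(local_unit noeth locm)[c ac]; apply: u0.
  by move: abuv; rewrite (sv _ mb) addr0 => au; rewrite -[u]scale1r -ac mulrC -scalerA au scaler0.
have [c bc] := local_unit noeth locm nb; exists (- (c * a)).
rewrite -[LHS]scale1r -bc mulrC -scalerA.
have -> : b *: v = - (a *: u) by apply/eqP; rewrite -addr_eq0 addrC abuv.
by rewrite scalerN scaleNr scalerA.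
Qed.

Lemma deep_regular_ring : deep m D R^o.
Proof. by rewrite -sD; apply: deep_wreg. Qed.

(** The class of [t] spans a copy of k in R/J, and the map taking it to [u] extends to R/J by
    [ext_prop_qs]; [v] is the image of 1. This is how the injectivity of [Wb] enters the duality
    argument. *)
Lemma quotient_baer (J : set R) t (u : Wb) : ideal J -> (forall y, y \in s -> J y) ->
  ~ J t -> (forall a, m a -> J (a * t)) -> soc m u -> u <> 0 ->
  exists2 v : Wb, forall a, J a -> a *: v = 0 & t *: v = u.
Proof.
move=> sJ Js Jt mJ su u0.
have [f _ fu] := soc_map noeth locm su u0.
pose pi : {linear R^o -> quo (J : set R^o)} := quo_pi (J : set R^o).
have pi0 a : pi a = 0 <-> J a.
  by rewrite quo_pi_eq0; split=> [|Ja]; [exact: (span_id sJ) | exact: sub_span].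
have piZ a b : a *: pi b = pi (a * b) by rewrite -linearZ.
have piS : surj pi by exact: quo_surj.
have [||i iI it] := @soc_map R m noeth locm _ (pi t); first by move=> a ma; rewrite piZ; apply/pi0/mJ.
  by move=> /pi0.
have is' := ses_quo iI; have [_ qS _] := is'.
have [||||g gE] := ext_prop_qs (p := [::]) (t := s) (W := w) _ _ rw rs is' _ _ f => //.
- by move=> A B C j q jq _ vC f'; apply: (van_restr Einj eI d0 dS f' jq vC).
- by move=> y ys v; have [b <-] := piS v; rewrite piZ; apply/pi0; rewrite mulrC; apply: (submodZ b sJ); apply: Js.
- rewrite /= sD; apply: (van_above Einj eI d0 dS noeth locm fw dimR deep_regular_ring Er) => //.
  by apply: fingen_surj qS _; apply: fingen_surj piS _; apply: fingen_regular.
exists (g (pi 1)) => [a Ja|]; first by rewrite -linearZ piZ mulr1 (pi0 a).2 ?linear0.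
by rewrite -linearZ piZ mulr1 -it gE fu.
Qed.

Lemma ideal_socle (J : set R) : ideal J -> (forall y, y \in s -> J y) -> ~ J 1 ->
  exists2 t, ~ J t & forall a, m a -> J (a * t).
Proof.
move=> sJ Js J1.
pose pi : {linear R^o -> quo (J : set R^o)} := quo_pi (J : set R^o).
have pi0 a : pi a = 0 <-> J a.
  by rewrite quo_pi_eq0; split=> [|Ja]; [exact: (span_id sJ) | exact: sub_span].
have piZ a b : a *: pi b = pi (a * b) by rewrite -linearZ.
have piS : surj pi by exact: quo_surj.
have [||u su u0] := socle_exists noeth locm dimR rs sD (V := quo (J : set R^o)) (v := pi 1).
- by move=> y ys v; have [b <-] := piS v; rewrite piZ; apply/pi0; rewrite mulrC; apply: (submodZ b sJ); apply: Js.
- by move=> /pi0.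
have [t tu] := piS u; exists t => [/pi0|a ma]; first by rewrite tu.
by apply/pi0; rewrite -piZ tu su.
Qed.

(** When [p] kills [W], this says that R/(p) → End(W) is bijective. *)
Definition scalar_endo (p : seq R) W :=
  (forall a, (forall v : W, a *: v = 0) -> @seq_mul R R^o p a) /\
  forall f : {linear W -> W}, exists a, forall v, f v = a *: v.

(** If [a] were outside (s), a socle element of R modulo ((s) : a) would give a multiple of [a] that
    spans a copy of k in R/(s); by [quotient_baer] this multiple does not kill [Wb]. *)
Lemma quotient_annihilator a : (forall v : Wb, a *: v = 0) -> @seq_mul R R^o s a.
Proof.
move=> aW; apply: contrapT => sa.
have sJ : ideal [set b | @seq_mul R R^o s (b * a)].
  split; first by rewrite /= mul0r; apply: span0.
  move=> b c c' /= h h'; rewrite mulrDl -mulrA; exact: spanP.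
have sB y b : y \in s -> @seq_mul R R^o s (y * b).
  by move=> ys; apply: sub_span; exists y => //; exists b.
have [||b nb mb] := ideal_socle sJ; first by move=> y /sB; apply.
  by rewrite /= mul1r.
have [u [su u0 _]] := socle_generator.
have [|||v _ bv] := @quotient_baer (@seq_mul R R^o s) (b * a) u _ _ nb _ su u0.
- exact: span_submodule.
- by move=> y ys; rewrite -[y]mulr1; apply: sB.
- by move=> c mc; rewrite mulrA; apply: mb.
by apply: u0; rewrite -bv -scalerA aW scaler0.
Qed.

(* Matlis duality for R/J, in terms of the submodule (0 : J) of Wb. *)
Lemma quotient_endo (J : set R) : @submodule R R^o J -> (forall y, y \in s -> J y) ->
  forall f : Wb -> Wb,
  (forall a u v, (forall b, J b -> b *: u = 0) -> (forall b, J b -> b *: v = 0) ->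
    f (a *: u + v) = a *: f u + f v) ->
  exists a : R, forall v, (forall b, J b -> b *: v = 0) -> f v = a *: v.
Proof.
(* A bare function [f], linear only on (0 : J), serves for all [J] at once, and no module structure
   on (0 : J) has to be formed. *)
move: J; apply: (noeth_ind noeth (fingen_regular R)) => J sJ IH Js f fl.
have f0 : f 0 = 0.
  have := fl 1 0 0 (fun b _ => scaler0 _ b) (fun b _ => scaler0 _ b).
  rewrite scale1r addr0 scale1r => h.
  by apply: (@addrI _ (f 0)); rewrite addr0 -h.
have [J1|J1] := pselect (J 1).
  by exists 0 => v /(_ 1 J1); rewrite scale1r => ->; rewrite scaler0 f0.
have [t Jt mt] := ideal_socle sJ Js J1.
have [u [su u0 ugen]] := socle_generator.
(* J' = J + Rt, so (0 : J') consists of the elements of (0 : J) killed by [t]. The induction gives a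
   scalar [a] there, and [v0] spans (0 : J) modulo (0 : J'). *)
pose J' : set R^o := [set a | exists c : R, J (a - c * t)].
have sJ' : submodule J'.
  split; first by exists 0; rewrite mul0r subr0; case: sJ.
  move=> a b b' [c bc] [c' bc']; exists (a * c + c').
  by rewrite mulrDl -mulrA opprD addrACA -[a *: b]/(a * b) -mulrBr; apply: sJ.2.
have JJ' : J `<=` J' by move=> a Ja; exists 0; rewrite mul0r subr0.
have J't : J' t by exists 1; rewrite mul1r subrr; case: sJ.
have J'P v : (forall b, J b -> b *: v = 0) -> t *: v = 0 -> forall b, J' b -> b *: v = 0.
  move=> Jv tv b [c /Jv bc]; rewrite -(subrK (c * t) b).
  by rewrite scalerDl bc -scalerA tv scaler0 addr0.
have [|||a aE] := IH J' sJ' _ _ f.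
- by split=> // /(_ t J't).
- by move=> y /Js /JJ'.
- by move=> a v v' v0 v0'; apply: fl => b /JJ'; [apply: v0 | apply: v0'].
have [v0 Jv0 tv0] := quotient_baer sJ Js Jt mt su u0.
have sfa : soc m (f v0 - a *: v0).
  move=> b mb; have h : forall c, J' c -> c *: (b *: v0) = 0.
    apply: J'P => [c Jc|]; first by rewrite scalerA mulrC -scalerA Jv0 // scaler0.
    by rewrite scalerA mulrC Jv0 //; apply: mt.
  have := fl b v0 0 Jv0 (fun c _ => scaler0 _ c); rewrite !addr0 f0 addr0 aE // => fb.
  by rewrite scalerBr -fb !scalerA mulrC subrr.
have [c cE] := ugen _ sfa.
(* The correction ct vanishes on (0 : J') and has at [v0] the missing value cu. *)
exists (a + c * t) => v Jv.
have stv : soc m (t *: v) by move=> b mb; rewrite scalerA; apply/Jv/mt.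
have [c' c'E] := ugen _ stv.
have h : forall b, J' b -> b *: (v - c' *: v0) = 0.
  apply: J'P => [b Jb|]; rewrite scalerBr; first by rewrite Jv // scalerA mulrC -scalerA Jv0 // scaler0 subr0.
  by rewrite c'E scalerA mulrC -scalerA tv0 subrr.
have fv : f v = c' *: f v0 + f (v - c' *: v0).
  rewrite -fl //; first by congr f; rewrite addrC subrK.
  by move=> b Jb; apply: h; apply: JJ'.
have fE : f v0 = a *: v0 + c *: u by rewrite -cE; zmod.
rewrite fv [f (v - _)]aE // fE scalerDl -[(c * t) *: v]scalerA c'E.
by rewrite !scalerDr !scalerN !scalerA [c' * a]mulrC [c' * c]mulrC; zmod.
Qed.

Lemma scalar_endo_quotient : scalar_endo s Wb.
Proof.
split; first exact: quotient_annihilator.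
move=> f; have [|||a aE] := @quotient_endo (@seq_mul R R^o s) _ _ f.
- exact: span_submodule.
- by move=> y ys; apply: sub_span; exists y => //; exists 1; rewrite [_ *: _]mulr1.
- by move=> a u v _ _; rewrite linearP.
exists a => v; apply: aE => b sb.
apply: (@kills_seq_mul _ Wb s); first exact: kills_quotient.
have [g gE] : exists g : {linear R^o -> Wb}, forall c, g c = c *: v.
  by apply: ex_linear => c c' c'' /=; rewrite scalerDl scalerA.
by rewrite -gE; apply: seq_mul_map.
Qed.

Lemma seq_mul_rcons V p x (u : V) : seq_mul (rcons p x) u ->
  exists v, seq_mul p (u - x *: v).
Proof.
elim: p V u => [|y p IH] V u /=.
  by move=> /seq_mul_cons /seq_mul_nil /mpi_eq0[v ->]; exists v; rewrite subrr; apply/seq_mul_nil.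
move=> /seq_mul_cons /IH[v h]; have [v' v'E] := mpi_surj v; exists v'.
by apply/seq_mul_cons; rewrite linearB linearZ /= [mpi _ _ v']v'E.
Qed.

(** Nakayama twice. A scalar killing [W] is xc modulo (p), where [c] kills [W] again as [x] is
    regular. An endomorphism is a scalar modulo [x], so it differs from that scalar by [x] times
    another endomorphism. *)
Lemma scalar_endo_mquo p x W : kills W p -> fingen W -> m x -> sreg x W ->
  scalar_endo (rcons p x) (mquo x W) -> scalar_endo p W.
Proof.
move=> kW fW mx rx [annW endW]; split.
  pose Z : set R^o := [set a | forall v : W, a *: v = 0].
  have sZ : submodule Z.
    split=> [v|a b c bZ cZ v]; first by rewrite scale0r.
    by rewrite scalerDl -scalerA bZ cZ scaler0 addr0.
  have [g gZ] := noeth sZ.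
  suff: Z `<=` @seq_mul R R^o p by apply.
  rewrite gZ; apply: (nakayama noeth locm mx); first exact: span_submodule.
  rewrite -gZ => a aZ; have [|c ac] := @seq_mul_rcons R^o p x a.
    by apply: annW => v; have [u <-] := mpi_surj v; rewrite -linearZ aZ linear0.
  exists c => // v; apply: rx.
  have [h hE] : exists h : {linear R^o -> W}, forall c, h c = c *: v.
    by apply: ex_linear => b b' b'' /=; rewrite scalerDl scalerA.
  have := kills_seq_mul kW (seq_mul_map h ac).
  rewrite hE scalerBl aZ sub0r => /eqP; rewrite oppr_eq0 => /eqP.
  by rewrite -[x *: (c : R^o)]/(x * c) -scalerA.
move=> f; pose B : set (hom_module W W) := [set g | exists a : R, forall v, (g : {linear W -> W}) v = a *: v].
apply: (@nakayama_fingen R m noeth locm _ x B (fingen_hom noeth fW fW) mx).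
  split; first by exists 0 => v; rewrite scale0r.
  by move=> a g h [b bE] [c cE]; exists (a * b + c) => v; rewrite [LHS]/= bE cE scalerDl scalerA.
move=> {}f; pose f' : {linear W -> W} := f.
have [|g gE] := @linear_factor R _ _ _ (mpi x W) (mpi x W \o f') (@mpi_surj R x W).
  by move=> v /mpi_eq0[u ->]; rewrite /= [f' _]linearZ mpi_scale.
have [a aE] := endW g.
have [||h hE] := @linear_corestr R _ _ _ (mulby x W) (f' \- (a \*: idfun)).
- exact: linear_inj.
- by move=> v; apply/mpi_eq0; rewrite linearB -[mpi x W (f' v)]gE aE [X in _ - X]linearZ subrr.
exists (h : hom_module W W), a => v.
rewrite -[LHS]/(f' v - x *: h v) -mulbyE hE /=; zmod.
Qed.

Lemma scalar_endo_qs t p W : kills W p -> fingen W -> (forall x, x \in t -> m x) ->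
  wreg W t -> scalar_endo (p ++ t) (qs W t) -> scalar_endo p W.
Proof.
elim: t p W => [|x t IH] p W kW fW mt; first by rewrite cats0.
move=> /wreg_cons[rx rt] h; apply: (scalar_endo_mquo kW fW (x := x)) => //.
  by apply: mt; rewrite inE eqxx.
apply: IH => //; last by rewrite cat_rcons.
- by rewrite -cats1; apply: (@kills_qs R W p [:: x]).
- exact: fingen_surj (@mpi_surj R x W) fW.
- by move=> y yt; apply: mt; rewrite inE yt orbT.
Qed.

Lemma canonical_endo : (forall a, (forall v : w, a *: v = 0) -> a = 0) /\
  forall f : {linear w -> w}, exists a, forall v, f v = a *: v.
Proof.
have [] := @scalar_endo_qs s [::] w _ fw ms rw scalar_endo_quotient => // h1 h2.
by split=> // a /h1 /seq_mul_nil.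
Qed.
End Endomorphisms.

(** * Canonical duality and tensor products *)

Section Duality.
Local Open Scope ring_scope.
Local Open Scope classical_set_scope.
Variables (R : comNzRingType) (w : lmodType R).
Implicit Types A B C K P U V W X Y Z N : lmodType R.
Variables (E : nat -> lmodType R) (e : {linear w -> E 0%N})
  (d : forall n, {linear E n -> E n.+1}).
Hypotheses (Einj : forall n, injective_module (E n)) (eI : injective e)
  (d0 : forall x, d 0%N x = 0 <-> exists y, x = e y)
  (dS : forall n x, d n.+1 x = 0 <-> exists y, x = d n y).
Variable m : set R.
Hypotheses (noeth : noetherian R) (locm : local_ring m) (fw : fingen w).
Variables (D r : nat).
Hypotheses (dimR : krull_dim R D) (Er : forall n, (r < n)%N -> trivial_module (E n))
  (deepR : deep m D R^o) (deepw : deep m D w)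
  (annw : forall a, (forall v : w, a *: v = 0) -> a = 0)
  (endw : forall f : {linear w -> w}, exists a, forall v, f v = a *: v).

Lemma ex_eval V W (v : V) : exists ev : {linear hom_module V W -> W},
  forall h : {linear V -> W}, ev h = h v.
Proof. by have [ev evE] := @ex_linear R (hom_module V W) W (fun h => (h : {linear V -> W}) v) (fun _ _ _ => erefl); exists ev. Qed.

Lemma ex_fpow_inj n W (i : 'I_n) : exists j : {linear W -> hom_module (fpow n R^o) W},
  forall (v : W) (u : fpow n R^o), (j v : {linear _ -> _}) u = (u i : R) *: v.
Proof.
have mk v : exists h : {linear fpow n R^o -> W}, forall u, h u = (u i : R) *: v.
  by apply: ex_linear => a u u'; rewrite !ffunE scalerDl scalerA.
have [j jE] := choice mk.
have [|l lE] := @ex_linear R W (hom_module (fpow n R^o) W) j.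
  move=> a v v'; apply: hom_ext => u; rewrite -[RHS]/(a *: j v u + j v' u) !jE.
  by rewrite scalerDr !scalerA mulrC.
by exists l => v u; rewrite lE jE.
Qed.

Lemma hom_fpow_basis n W : exists (j : 'I_n -> {linear W -> hom_module (fpow n R^o) W})
    (pr : 'I_n -> {linear hom_module (fpow n R^o) W -> W}),
  [/\ forall i v u, (j i v : {linear _ -> _}) u = (u i : R) *: v,
      forall i (h : {linear fpow n R^o -> W}), pr i h = h (fgen R i) &
      forall h, h = \sum_i j i (pr i h)].
Proof.
have [j jE] := choice (fun i => @ex_fpow_inj n W i).
have [pr prE] := choice (fun i => @ex_eval (fpow n R^o) W (fgen R i)).
exists j, pr; split=> // h; apply: hom_ext => u.
have [ev evE] := @ex_eval (fpow n R^o) W u.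
rewrite -evE -[RHS]evE linear_sum {1}evE {1}(fgen_sum u) linear_sum.
by apply: eq_bigr => i _; rewrite evE jE prE linearZ.
Qed.

Lemma deep_hom_fpow n j W : deep m j W -> deep m j (hom_module (fpow n R^o) W).
Proof.
move=> dW i ij; have [jj [pr [_ _ sumE]]] := hom_fpow_basis n W.
exact: exv_sum sumE (dW i ij).
Qed.

Lemma dual_ses A B C (i : {linear A -> B}) (p : {linear B -> C}) :
  ses i p -> van d 1 C -> ses (hom_map w p) (hom_map w i).
Proof.
move=> ip vC; have [iI pS pK] := ip; split.
- apply: linear_inj => h hp; apply: hom_ext => c; have [b <-] := pS c.
  by have := congr1 (fun f : {linear B -> w} => f b) hp.
- move=> f; have [g gE] := van_restr Einj eI d0 dS f ip vC.
  by exists g; apply: hom_ext => a; apply: gE.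
- move=> h; split=> [hi|[g ->]]; last first.
    by apply: hom_ext => a; rewrite /= (ses0 _ ip) linear0.
  have [|g gE] := linear_factor (g := h) pS.
    by move=> b /pK[a ->]; have := congr1 (fun f : {linear A -> w} => f a) hi.
  by exists g; apply: hom_ext => b; rewrite -gE.
Qed.

Section Syzygy.
Variables (N : lmodType R) (n : nat) (p : {linear fpow n R^o -> N}).
Hypotheses (pS : surj p) (fN : fingen N) (dN : deep m D N).

Lemma fingen_syz : fingen (ker p).
Proof. by apply: (fingen_inj noeth (@ker_incl_inj _ _ _ p)); apply: fingen_fpow; apply: fingen_regular. Qed.

Lemma deep_syz : deep m D (ker p).
Proof.
apply: (deep_sub (ses_ker pS)); last exact: deep_fpow.
by apply: deepW dN; apply: leq_pred.
Qed.

Lemma dual_syz : ses (hom_map w p) (hom_map w (ker_incl p)).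
Proof.
apply: dual_ses; first exact: ses_ker.
exact: (van_deep Einj eI d0 dS noeth locm fw dimR deepR Er).
Qed.
End Syzygy.

(** The dual of a presentation embeds N† in a power of ω with cokernel the dual of the syzygy, which
    is again deep; each such step gains one unit of depth. *)
Lemma deep_dual N : fingen N -> deep m D N -> deep m D (hom_module N w).
Proof.
suff H j : forall N, (j <= D)%N -> fingen N -> deep m D N -> deep m j (hom_module N w) by apply: H.
elim: j => [|j IH] {}N jD fN dN //.
have [n [p pS]] := (fingenP N).1 fN.
apply: (deep_sub (dual_syz pS fN dN)) => /=; last by apply: deep_hom_fpow; apply: deepW deepw.
by apply: IH; [exact: ltnW | exact: fingen_syz | exact: deep_syz].
Qed.

(** The dual of the syzygy has no Ext^1 into ω, so [phi] extends to a power of ω. There it is given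
    by scalars [a], as End(ω) = R, and these are the coordinates of a preimage of [v]. *)
Lemma bidual_surj N (phi : {linear hom_module N w -> w}) : fingen N -> deep m D N ->
  exists v, forall h : {linear N -> w}, phi h = h v.
Proof.
move=> fN dN; have [n [p pS]] := (fingenP N).1 fN.
have [|psi psiE] := van_restr Einj eI d0 dS phi (dual_syz pS fN dN).
  apply: (van_deep Einj eI d0 dS noeth locm fw dimR deepR Er).
    by apply: fingen_hom => //; apply: fingen_syz.
  by apply: deep_dual; [apply: fingen_syz | apply: deep_syz].
have [j [pr [jE prE sumE]]] := hom_fpow_basis n w.
have [a aE] := choice (fun i => endw (psi \o j i)).
exists (p (\sum_i a i *: fgen R i)) => h.
rewrite -psiE (sumE (hom_map w p h)) !linear_sum; apply: eq_bigr => i _.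
have /= -> := aE i (pr i (hom_map w p h)).
by rewrite prE !linearZ.
Qed.

(** Evaluation at a lift [y] of [v] kills N†, so it factors through the dual of the syzygy and is
    evaluation at some [z] there. Faithfulness of ω gives y = z, which [p] sends to zero. *)
Lemma bidual_inj N (v : N) : fingen N -> deep m D N ->
  (forall h : {linear N -> w}, h v = 0) -> v = 0.
Proof.
move=> fN dN hv; have [n [p pS]] := (fingenP N).1 fN.
have [y yv] := pS v; have ds := dual_syz pS fN dN; have [_ dS' dK] := ds.
have [ev evE] := @ex_eval (fpow n R^o) w y.
have [|psi psiE] := linear_factor (g := ev) dS'.
  by move=> h /dK[g ->]; rewrite evE /= yv hv.
have [z zE] := bidual_surj psi (fingen_syz p) (deep_syz pS dN).
suff -> : v = p (ker_incl p z) by exact: kerP.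
rewrite -yv; congr (p _); apply/ffunP => i.
have [j [_ [jE _ _]]] := hom_fpow_basis n w.
apply/eqP; rewrite -subr_eq0; apply/eqP/annw => u.
rewrite scalerBl -!jE -evE -psiE zE; apply/eqP; rewrite subr_eq0; apply/eqP.
by [].
Qed.

Lemma ext_tens X Y Z (f g : {linear tensor X Y -> Z}) :
  (forall x y, f (tens x y) = g (tens x y)) -> f =1 g.
Proof.
move=> fg t; have [z <-] := quo_surj t.
by apply: (@free_ext R _ Z (f \o quo_pi _) (g \o quo_pi _)) => -[x y]; apply: fg.
Qed.

Lemma tens_span X Y (S : set (tensor X Y)) : submodule S ->
  (forall x y, S (tens x y)) -> forall t, S t.
Proof.
move=> sS St t; apply: (span_id sS); apply/quo_pi_eq0.
apply: (@ext_tens X Y _ (quo_pi S) \0) => x y.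
by apply/quo_pi_eq0; apply: sub_span.
Qed.

Lemma fingen_tensor X Y : fingen X -> fingen Y -> fingen (tensor X Y).
Proof.
move=> [s sX] [t tY]; exists [seq tens x y | x <- s, y <- t]; apply/seteqP; split=> // z _.
apply: tens_span; first exact: span_submodule.
move=> x y; have : lin_span [set` s] x by rewrite sX.
suff: lin_span [set` s] `<=` [set x | lin_span [set` [seq tens x y | x <- s, y <- t]] (tens x y)] by apply.
have lx y' : exists l : {linear X -> tensor X Y}, forall x, l x = tens x y'.
  by apply: ex_linear => a u v; rewrite tens_linearl.
apply: span_sub => [|{}x xs].
  have [l lE] := lx y; split=> [|a u v /= su sv]; first by rewrite /= -lE linear0; apply: span0.
  by rewrite -lE linearP !lE; apply: spanP.
have : lin_span [set` t] y by rewrite tY.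
suff: lin_span [set` t] `<=` [set y | lin_span [set` [seq tens x y | x <- s, y <- t]] (tens x y)] by apply.
have [l lE] : exists l : {linear Y -> tensor X Y}, forall y, l y = tens x y.
  by apply: ex_linear => a u v; rewrite tens_linearr.
apply: span_sub => [|{}y yt].
  split=> [|a u v /= su sv]; first by rewrite /= -lE linear0; apply: span0.
  by rewrite -lE linearP !lE; apply: spanP.
by apply: span_mem; apply: allpairs_f.
Qed.

(** Surjections of [X] and [Y] onto k combine into a nonzero bilinear map to k, the product of
    residues. [c] picks representatives, on which the product does not depend by [km]. *)
Lemma tensor_neq0 X Y : fingen X -> fingen Y -> ~ trivial_module X -> ~ trivial_module Y ->
  ~ trivial_module (tensor X Y).
Proof.
move=> fX fY X0 Y0 t0.
have [f fS] := map_to_residue noeth locm fX X0.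
have [g gS] := map_to_residue noeth locm fY Y0.
have [c cE] := choice (@residueP R m).
have km a b (u : residue_field m) : a *: kone m = b *: kone m -> a *: u = b *: u.
  by move=> ab; have [l ->] := residueP u; rewrite !scalerA ![_ * l]mulrC -!scalerA ab.
have [x0 fx] := fS (kone m); have [y0 gy] := gS (kone m).
have bl y : linear (fun x => c (f x) *: g y).
  move=> a x x' /=; rewrite scalerA -scalerDl; apply: km.
  by rewrite -cE scalerDl -scalerA -!cE linearP.
have br x : linear (fun y => c (f x) *: g y).
  by move=> a y y' /=; rewrite linearP scalerDr !scalerA mulrC.
have := tensor_liftE bl br x0 y0; rewrite (t0 (tens x0 y0)) linear0 fx gy -cE.
by move/esym; rewrite -[kone m]scale1r => /(residue_eq0 locm) /(max_proper locm).
Qed.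

(** A section [q] of [p] defines the inverse map from C ⊗ Y to the cokernel of the first map; modulo
    the image the choice of preimages does not matter. *)
Lemma tensor_exact A B C Y (i : {linear A -> B}) (p : {linear B -> C}) :
  surj p -> (forall b, p b = 0 <-> exists a, b = i a) ->
  surj (tensor_map Y p) /\
  forall t, tensor_map Y p t = 0 <-> exists u, t = tensor_map Y i u.
Proof.
move=> pS pK; have im_sub U V (f : {linear U -> V}) : submodule [set v | exists u, v = f u].
  split; first by exists 0; rewrite linear0.
  by move=> a _ _ [u ->] [v ->]; exists (a *: u + v); rewrite linearP.
split.
  have sI : submodule [set t | exists u, tensor_map Y p u = t].
    split; first by exists 0; rewrite linear0.
    by move=> a _ _ [u <-] [v <-]; exists (a *: u + v); rewrite linearP.
  apply: (tens_span sI) => c y; have [b <-] := pS c.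
  by exists (tens b y); rewrite tensor_mapE.
have ip a : p (i a) = 0 by apply/pK; exists a.
move=> t; split=> [pt|[u ->]]; last first.
  apply: (@ext_tens A Y _ (tensor_map Y p \o tensor_map Y i) \0) => a y.
  rewrite -[LHS]/(tensor_map Y p (tensor_map Y i (tens a y))) 2!tensor_mapE ip.
  have [l lE] : exists l : {linear C -> tensor C Y}, forall x, l x = tens x y.
    by apply: ex_linear => b u' v; rewrite tens_linearl.
  by rewrite -lE linear0.
have [q qE] := choice pS; set S := [set v | exists u, v = tensor_map Y i u].
have tq b b' y : p b = p b' -> quo_pi S (tens b y) = quo_pi S (tens b' y).
  move=> pb; have /pK[a ab] : p (b - b') = 0 by rewrite linearB pb subrr.
  have [l lE] : exists l : {linear B -> tensor B Y}, forall x, l x = tens x y.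
    by apply: ex_linear => b0 u' v; rewrite tens_linearl.
  apply/eqP; rewrite -subr_eq0 -linearB -!lE -linearB ab lE; apply/eqP.
  by apply/quo_pi_eq0; apply: sub_span; exists (tens a y); rewrite tensor_mapE.
have bl y : linear (fun c => quo_pi S (tens (q c) y)).
  move=> a c c' /=; rewrite -linearP -tens_linearl; apply: tq.
  by rewrite linearP !qE.
have br c : linear (fun y => quo_pi S (tens (q c) y)).
  by move=> a y y' /=; rewrite tens_linearr linearP.
have H : (tensor_lift bl br \o tensor_map Y p) =1 quo_pi S.
  apply: ext_tens => b y.
  rewrite -[LHS]/(tensor_lift bl br (tensor_map Y p (tens b y))) tensor_mapE tensor_liftE.
  by apply: tq; rewrite qE.
apply: (span_id (im_sub _ _ (tensor_map Y i))); apply/quo_pi_eq0.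
by rewrite -H -[LHS]/(tensor_lift bl br (tensor_map Y p t)) pt linear0.
Qed.

(** The tensor product is a direct sum of copies of [Y], so primitives are chosen generator by
    generator and assembled bilinearly. *)
Lemma van_free_tensor (K : choiceType) Y n : van d n.+1 Y -> van d n.+1 (tensor (free_mod R K) Y).
Proof.
move=> vY f fd.
have /choice[g gE] : forall k : K, exists g : {linear Y -> E n},
    forall y, f (tens (free_gen R k) y) = d n (g y).
  move=> k; have [l lE] : exists l : {linear Y -> E n.+1}, forall y, l y = f (tens (free_gen R k) y).
    by apply: ex_linear => a u v; rewrite tens_linearr linearP.
  have [|g gE] := vY l; first by move=> y; rewrite lE fd.
  by exists g => y; rewrite -lE gE.
pose b z y := free_lift (fun k => g k y) z.
have bE z y : b z y = \sum_(k <- dom z) coeff k z *: g k y.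
  rewrite /b {1}(free_sum z) linear_sum; apply: eq_bigr => k _.
  by rewrite linearZ; congr (_ *: _); apply: free_liftE.
have bl y : linear (b^~ y) by move=> a z z'; rewrite /b linearP.
have br z : linear (b z).
  move=> a y y'; rewrite !bE scaler_sumr -big_split; apply: eq_bigr => k _ /=.
  by rewrite linearP scalerDr !scalerA mulrC.
exists (tensor_lift bl br); apply: (@ext_tens _ _ _ f (d n \o tensor_lift bl br)) => z y.
rewrite -[RHS]/(d n (tensor_lift bl br (tens z y))) tensor_liftE /b.
have [l lE] : exists l : {linear free_mod R K -> E n.+1}, forall z, l z = f (tens z y).
  by apply: ex_linear => a u v; rewrite tens_linearl linearP.
rewrite -lE; apply: (@free_ext R K _ l (d n \o free_lift (fun k => g k y))) => k /=.
by rewrite lE gE [free_lift_fun _ _](@free_liftE R K).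
Qed.

Section HomTensor.
Variable N : lmodType R.
Hypotheses (fN : fingen N) (dN : deep m D N).
Notation N' := (hom_module N w).

Lemma tensor_of_hom (F : lmodType R) (phi : {linear F -> N}) :
  exists f : {linear tensor F N' -> w}, forall z (h : {linear N -> w}), f (tens z (h : N')) = h (phi z).
Proof.
have bl (h : N') : linear (fun z => (h : {linear N -> w}) (phi z)).
  by move=> a z z'; rewrite !linearP.
have br z : linear (fun h : N' => (h : {linear N -> w}) (phi z)) by [].
by exists (tensor_lift bl br) => z h; rewrite tensor_liftE.
Qed.

(** The inverse to [tensor_of_hom]: the adjunction gives a map from [F] to N††, and biduality brings
    its values back to [N]. *)
Lemma hom_of_tensor (F : lmodType R) (f : {linear tensor F N' -> w}) :
  exists phi : {linear F -> N}, forall z (h : {linear N -> w}), f (tens z (h : N')) = h (phi z).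
Proof.
have mk z : exists v, forall h : {linear N -> w}, f (tens z (h : N')) = h v.
  have [l lE] : exists l : {linear N' -> w}, forall h, l h = f (tens z h).
    by apply: ex_linear => a u v; rewrite tens_linearr linearP.
  have [v vE] := bidual_surj l fN dN.
  by exists v => h; rewrite -lE vE.
have [v vE] := choice mk.
have [|phi phiE] := @ex_linear R F N v; last by exists phi => z h; rewrite phiE.
move=> a z z'; apply/eqP; rewrite -subr_eq0; apply/eqP/(bidual_inj fN dN) => h.
by rewrite linearB linearP -!vE tens_linearl linearP subrr.
Qed.

Lemma van_tensor M i :
  (forall j, (1 <= j <= i.+1)%N -> trivial_module (Tor j M N')) ->
  van d i.+1 (tensor M N') <-> exv i.+1 M N.
Proof.
move=> tor.
have [cS cK] := @tensor_exact _ _ _ N' (res_diff M 1) (cover M) (@cover_surj R M)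
  (fun b => conj (fun h => @cover_ker R M 0 b h) (fun h => let: ex_intro a ba := h in
     eq_ind_r (fun b => cover M b = 0) (@cover_diff R M 0 a) ba)).
have dlE n z h : tensor_map N' (res_diff M n.+1) (tens z h) = tens (res_diff M n.+1 z) h by exact: tensor_mapE.
have zero_tens n h : tens (0 : res M n) h = 0 :> tensor (res M n) N'.
  have [l lE] : exists l : {linear res M n -> tensor (res M n) N'}, forall x, l x = tens x h.
    by apply: ex_linear => b u' v; rewrite tens_linearl.
  by rewrite -lE linear0.
rewrite (van_chase Einj eI d0 dS (T := fun n => tensor (res M n) N')
  (dl := fun n => tensor_map N' (res_diff M n.+1)) cS cK).
- split=> H.
  + move=> phi phid; have [f fE] := tensor_of_hom phi.
    have [|g gE] := H f.
      apply: (@ext_tens _ _ _ (f \o tensor_map N' (res_diff M i.+2)) \0) => z h.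
      by rewrite -[LHS]/(f (tensor_map N' (res_diff M i.+2) (tens z h))) dlE fE phid linear0.
    have [ga gaE] := hom_of_tensor g; exists ga => z.
    apply/eqP; rewrite -subr_eq0; apply/eqP/(bidual_inj fN dN) => h.
    by rewrite linearB -fE gE dlE gaE subrr.
  + move=> f fd; have [phi phiE] := hom_of_tensor f.
    have [|ga gaE] := H phi.
      by move=> z; apply: (bidual_inj fN dN) => h; rewrite -phiE -dlE fd.
    have [g gE] := tensor_of_hom ga; exists g.
    apply: (@ext_tens _ _ _ f (g \o tensor_map N' (res_diff M i.+1))) => z h.
    by rewrite -[RHS]/(g (tensor_map N' (res_diff M i.+1) (tens z h))) dlE gE phiE gaE.
- move=> n; apply: (@ext_tens _ _ _ (tensor_map N' (res_diff M n.+1) \o tensor_map N' (res_diff M n.+2)) \0) => z h.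
  rewrite -[LHS]/(tensor_map N' (res_diff M n.+1) (tensor_map N' (res_diff M n.+2) (tens z h))) 2!dlE.
  by rewrite [X in tens X _](@diff_diff R M n.+1 z) zero_tens.
(* Exactness at T_{n+1} for n up to i is the vanishing of Tor in degrees 1 to i + 1. *)
- move=> n ni t tn; have /homology_trivial := tor n.+1 ni; exact.
- move=> n j; apply: van_free_tensor.
  by apply: (van_deep Einj eI d0 dS noeth locm fw dimR deepR Er); [exact: fingen_hom | exact: deep_dual].
Qed.
End HomTensor.

(** The free resolution of [A] is itself a resolution by acyclic modules, so [van_chase] identifies
    the two models of Ext. *)
Lemma van_exv i A : van d i.+1 A <-> exv i.+1 A w.
Proof.
rewrite (van_chase Einj eI d0 dS (T := res A) (dl := fun n => res_diff A n.+1) (@cover_surj R A)) //.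
- move=> b; split=> [/(@cover_ker R A 0)//|[a ->]]; exact: (@cover_diff R A 0 a).
- by move=> n t; exact: (@diff_diff R A n.+1 t).
- move=> n _ t tn; apply: (@cover_ker R A n.+1).
  by apply: (@ker_incl_inj _ _ _ (cover (syzygy A n))); rewrite linear0.
- by move=> n j; apply: van_proj => //; apply: free_projective.
Qed.

Lemma deep_of_van X : ~ van d D (residue_field m) -> fingen X ->
  (forall i, (i < D)%N -> van d i.+1 X) -> deep m D X.
Proof.
move=> nvk fX vX.
(* After division by [j] elements only the degrees above [j] are still known to vanish, as each
   division costs the lowest one; [t] elements remain to be found. *)
suff H t : forall X j, fingen X -> (j + t = D)%N -> (forall i, (j <= i < D)%N -> van d i.+1 X) ->
    exists s, [/\ size s = t, forall x, x \in s -> m x & wreg X s].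
  have [|s [sD ms rs]] := H D X 0%N fX (add0n _); first by move=> i; apply: vX.
  by rewrite -sD; apply: deep_wreg.
elim: t => [|t IH] {vX fX} X j fX jt vX; first by exists [::].
have [[x mx rx]|nox] := pselect (exists2 x, m x & sreg x X).
  have [|||s [st ms rs]] := IH (mquo x X) j.+1; rewrite ?addSnnS //.
  - exact: fingen_surj (@mpi_surj R x X) fX.
  - case=> [//|i] /andP[ji iD]; apply: (van_quo Einj dS (ses_mul rx)); apply: vX.
      by rewrite -ltnS ji ltnW.
    by rewrite iD ltnW.
  exists (x :: s); split; [by rewrite /= st | | exact/wreg_cons].
  by move=> y; rewrite inE => /orP[/eqP ->|/ms].
have [u su u0] : exists2 u : X, soc m u & u <> 0.
  apply: contrapT => nu; apply: nox; apply: (exists_regular noeth locm fX) => u su.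
  by apply: contrapT => u0; apply: nu; exists u.
have [f fI _] := soc_map noeth locm su u0; have fs := ses_quo fI; have [_ qS _] := fs.
case: nvk; have -> : D = D.-1.+1 by rewrite prednK // -jt addnS.
have D0 : (0 < D)%N by rewrite -jt addnS.
apply: (van_sub Einj dS fs).
  by apply: vX; rewrite prednK // leqnn andbT -ltnS prednK // -jt addnS ltnS leq_addr.
rewrite prednK //; apply: (van_above Einj eI d0 dS noeth locm fw dimR deepR Er) => //.
exact: fingen_surj qS fX.
Qed.
End Duality.

(** * Maximal Cohen-Macaulay modules in terms of Ext, and the equivalence *)

Section MaximalCM.
Local Open Scope ring_scope.
Local Open Scope classical_set_scope.
Variables (R : comNzRingType) (m : set R) (D : nat).
Implicit Types V W X : lmodType R.
Hypotheses (noeth : noetherian R) (locm : local_ring m) (dimR : krull_dim R D).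

Lemma krull_dim_unique n : krull_dim R n -> n = D.
Proof.
move=> [[c cn] maxn]; have [[c' cD] maxD] := dimR.
by apply/anti_leq; rewrite (maxD _ _ cn) (maxn _ _ cD).
Qed.

Lemma maximal_CM_depth X : maximal_CM m X -> depth m X D.
Proof. by move=> [_ [n dX /krull_dim_unique <-]]. Qed.

Lemma maximal_CM_deep X : maximal_CM m X -> deep m D X.
Proof. by move=> /maximal_CM_depth[[s [ms rs _] <-] _]; apply: deep_wreg. Qed.

Lemma maximal_CM_nontrivial X : maximal_CM m X -> ~ trivial_module X.
Proof.
move=> /maximal_CM_depth[[s [_ _ sX] _] _] tX; apply: sX; apply/seteqP; split=> // v _.
by rewrite (_ : v = 0); [apply: span0 | apply: tX].
Qed.

Lemma depth_unique X n l : depth m X n -> depth m X l -> n = l.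
Proof.
move=> [[s rs sn] maxn] [[t rt tl] maxl].
by apply/anti_leq; rewrite -{1}sn -{2}tl maxl // maxn.
Qed.

(** For the upper bound on the depth, [s] of length [D] is regular on R and [X]. Then X/(s)X is
    nonzero and killed by [s], so it has a socle, whereas a regular sequence longer than [D] would
    forbid one. *)
Lemma deep_maximal_CM X : deep m D R^o -> fingen X -> ~ trivial_module X ->
  deep m D X -> maximal_CM m X.
Proof.
move=> dR fX X0 dX; split=> //; exists D => //; split.
  have [s [sD ms rs]] := deep_seq noeth locm fX dX; exists s => //; split=> // sT.
  apply: (qs_regular_neq0 noeth locm ms fX X0) => v; have [u <-] := qpi_surj v.
  by apply/qpi_eq0; rewrite sT.
move=> t [mt rt _]; rewrite leqNgt; apply/negP => Dt.
have [s [sD ms rs]] := deep_seq noeth locm (fingen_pair (fingen_regular R) fX) (deep_pair dR dX).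
have dX' : deep m (size s + 1) X by rewrite sD addn1; apply: deepW Dt _; apply: deep_wreg.
have /existsNP[v v0] := qs_regular_neq0 noeth locm ms fX X0.
have ks : kills (qs X s) s by exact: (@kills_quotient R s X).
have [u su u0] := socle_exists noeth locm dimR (wreg_fst rs) sD ks v0.
by apply: u0; apply: (deep_nosoc noeth locm (deep_qs (wreg_snd rs) dX')).
Qed.

Lemma CM_type1_thin w : depth m w D -> CM_type m w 1 -> thin m D w.
Proof.
move=> dw [t /depth_unique/(_ dw) -> [phi /bij_inj phiI]] f1 f2 f1d f2d.
set Z := ker (hom_map w (res_diff (residue_field m) D.+1)).
have cyc (f : {linear res (residue_field m) D -> w}) :
    (forall z, f (res_diff (residue_field m) D.+1 z) = 0) ->
    exists z : Z, (f : hom_module _ _) = ker_incl _ z.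
  by move=> fd; apply: ex_ker; apply: hom_ext.
have [z1 z1E] := cyc _ f1d; have [z2 z2E] := cyc _ f2d.
pose pr : {linear Z -> Ext D (residue_field m) w} := quo_pi _.
have [a1 a1E] := residueP (phi (pr z1) ord0).
have [a2 a2E] := residueP (phi (pr z2) ord0).
(* The residues of [a1] and [a2] are the coordinates of the two classes in the line Ext^D(k, w). *)
have [a [b [ab abE]]] : exists a b : R, (~ m a \/ ~ m b) /\ m (a * a1 + b * a2).
  have [ma1|na1] := pselect (m a1).
    exists 1, 0; rewrite mul1r mul0r addr0; split=> //.
    by left; apply: max_proper locm.
  exists (- a2), a1; split; first by right.
  by rewrite mulNr mulrC addNr; case: (max_ideal locm).
exists a, b; split=> //.
have phi0 : phi (pr (a *: z1 + b *: z2)) = phi 0.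
  rewrite linear0 !linearD !linearZ /=; apply/ffunP => i; rewrite !ffunE ord1.
  by rewrite [phi _ _]a1E [X in _ + _ *: X]a2E !scalerA -scalerDl; apply/(residue_eq0 locm).
have /quo_pi_eq0 := phiI _ _ phi0.
move/(@span_id _ _ [set z : Z | exists g, ker_incl _ z = hom_map w (res_diff _ D) g]).
case=> [|g gE].
  split; first by exists 0; rewrite !linear0.
  by move=> c x y [u xu] [v yv]; exists (c *: u + v); rewrite !linearP xu yv.
exists g => z; have := congr1 (fun h : {linear _ -> _} => h z) gE.
by rewrite linearD !linearZ -z1E -z2E.
Qed.

Lemma CM_type1_Ext w : depth m w D -> CM_type m w 1 ->
  ~ trivial_module (Ext D (residue_field m) w).
Proof.
move=> dw [t /depth_unique/(_ dw) -> [phi [psi _ phiK]]] ext0.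
have := phiK [ffun=> kone m]; rewrite (ext0 (psi _)) linear0 => /ffunP/(_ ord0).
rewrite !ffunE => /esym; rewrite -[kone m]scale1r => /(residue_eq0 locm).
exact: max_proper locm.
Qed.
End MaximalCM.

Theorem corollary2p6 (R : comNzRingType) (m : set R) (d : nat)
    (w M N : lmodType R) :
  noetherian R -> local_ring m ->
  maximal_CM m (R^o)%R -> krull_dim R d -> (1 <= d)%N ->
  canonical_module m w ->
  fingen M -> ~ trivial_module M -> fingen N -> maximal_CM m N ->
  (forall j : nat, (1 <= j <= d)%N -> trivial_module (Tor j M (canonical_dual w N))) ->
  (maximal_CM m (tensor M (canonical_dual w N)) <->
   forall i : nat, (1 <= i <= d)%N -> trivial_module (Ext i M N)).
Proof.
move=> noeth locm cmR dimR d_gt0 [cmw tyw [E [e [dl [Einj eI d0 dS [r Er]]]]]] fM M0 fN cmN tor.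
have deepR := maximal_CM_deep locm dimR cmR.
have deepw := maximal_CM_deep locm dimR cmw.
have deepN := maximal_CM_deep locm dimR cmN.
have depw := maximal_CM_depth dimR cmw.
have fw := cmw.1.
have [s [sd ms rs]] := deep_seq noeth locm (fingen_pair (fingen_regular R) fw) (deep_pair deepR deepw).
have [annw endw] := canonical_endo Einj eI d0 dS noeth locm fw dimR ms (wreg_fst rs) sd Er
  (wreg_snd rs) (CM_type1_thin locm depw tyw) (maximal_CM_nontrivial dimR cmw).
have fN' : fingen (canonical_dual w N) by apply: fingen_hom.
have N'0 : ~ trivial_module (canonical_dual w N).
  (* If N† were zero, injectivity of N → N†† would make [N] zero. *)
  move=> N'0; apply: (maximal_CM_nontrivial dimR cmN) => v.
  apply: (bidual_inj Einj eI d0 dS noeth locm fw dimR Er deepR deepw annw endw fN deepN) => h.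
  by rewrite (N'0 h).
have fX := fingen_tensor fM fN'.
have X0 := tensor_neq0 noeth locm fM fN' M0 N'0.
have vanE i : (i < d)%N -> van dl i.+1 (tensor M (canonical_dual w N)) <-> trivial_module (Ext i.+1 M N).
  move=> id; rewrite Ext_trivial.
  apply: (van_tensor Einj eI d0 dS noeth locm fw dimR Er deepR deepw annw endw fN deepN) => j /andP[j0 ji].
  by apply: tor; rewrite j0 (leq_trans ji id).
split=> [cmX [//|i] /andP[_ id]|extv].
  apply/vanE => //; apply: (van_deep Einj eI d0 dS noeth locm fw dimR deepR Er) => //.
  exact: (maximal_CM_deep locm dimR cmX).
apply: (deep_maximal_CM noeth locm dimR deepR fX X0).
apply: (deep_of_van Einj eI d0 dS noeth locm fw dimR Er deepR) => // [|i id]; last first.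
  by apply/vanE => //; apply: extv.
have := CM_type1_Ext locm depw tyw.
(* [van_exv] concerns positive degrees, and d ≥ 1 puts Ext^d(k, ω) in its range. *)
case: (d) d_gt0 => // d' _; rewrite Ext_trivial => nk vk; apply: nk.
exact/(van_exv Einj eI d0 dS).
Qed.
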